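(* Let $q\in\mathbb{N}$ be a positive integer, let $\delta,b,c>0$ be real, and let $p$ be real with $p+1>0$. Put $a=\frac{p}{\delta}+\frac{b+2}{2}$ and $g={}_{q}g_{p,b,c,\delta}$. Then the radius of convexity $r^{c}(g)$ is the smallest positive root of the equation $\left(z\,g'(z)\right)'=0$ and satisfies $$\frac{2}{3}\sqrt{\frac{\Gamma(q+a)}{c\,\Gamma(a)}}<r^{c}(g)<6\sqrt{\frac{\Gamma(q+a)\Gamma(2q+a)}{c\left\{81\,\Gamma(a)\Gamma(2q+a)-25\,\Gamma^{2}(q+a)\right\}}}.$$
   Context: The generalized Struve function is $${}_{q}W_{p,b,c,\delta}(z)=\sum_{n\geq 0}\frac{(-1)^{n}c^n}{n!\,\Gamma\left(qn+\frac{p}{\delta}+\frac{b+2}{2}\right)}\left(\frac{z}{2}\right)^{2n+p+1},\qquad q\in\mathbb{N},\ \delta>0,$$ and its normalization $${}_{q}g_{p,b,c,\delta}(z)=2^{p+1}\Gamma\left(\tfrac{p}{\delta}+\tfrac{b+2}{2}\right)z^{-p}\,{}_{q}W_{p,b,c,\delta}(z)$$ is the entire function obtained by cancelling the powers of $z$ in the series; it has value $0$ and derivative $1$ at $0$. With $\mathbb{D}_r=\{z\in\mathbb{C}:|z|<r\}$, the radius of convexity of $F$ is $$r^{c}(F)=\sup\left\{r>0:\ \operatorname{Re}\left(1+\frac{zF''(z)}{F'(z)}\right)>0\ \text{for all } z\in\mathbb{D}_r\right\}.$$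
   Formalization: The condition a = p/δ + (b+2)/2 > 0 is added; without it the claim fails, e.g. q=1, δ=1/10, b=c=1, p=−0.19 gives a=−0.4 and both radicands in the bounds are negative. *)

(* Defs.v *)
From Stdlib Require Import Reals Factorial Lra.
From Coquelicot Require Import Coquelicot.
Open Scope R_scope.

(* Euler's integral; it represents the Gamma function for x > 0 only, which is
   the only range in which it is used. *)
Definition Gamma (x : R) : R :=
  RInt_gen (fun t : R => Rpower t (x - 1) * exp (- t))
           (at_right 0) (Rbar_locally p_infty).

Definition CSeries (u : nat -> C) : C :=
  (Series (fun n => Re (u n)), Series (fun n => Im (u n))).

Definition struve_a (p b delta : R) : R := p / delta + (b + 2) / 2.

Definition struve_coef (q : nat) (p b c delta : R) (n : nat) : R :=
  (-1) ^ n * c ^ n / (INR (fact n) * Gamma (INR q * INR n + struve_a p b delta)).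

(* The power (z/2)^(2n+p+1) is multivalued off the positive half-line when p is
   not an integer, so W is given as a function of x > 0. *)
Definition struve_W (q : nat) (p b c delta : R) (x : R) : R :=
  Series (fun n => struve_coef q p b c delta n
                   * Rpower (x / 2) (2 * INR n + p + 1)).

(* 2^(p+1) Gamma(a) z^(-p) W(z) with the powers of z cancelled in the series;
   see [struve_g_W]. *)
Definition struve_g (q : nat) (p b c delta : R) (z : C) : C :=
  CSeries (fun n =>
    (RtoC (Gamma (struve_a p b delta) * struve_coef q p b c delta n / 4 ^ n)
     * z ^ (2 * n + 1))%C).

Lemma struve_g_W (q : nat) (p b c delta x : R) : 0 < x ->
  struve_g q p b c delta (RtoC x)
  = RtoC (Rpower 2 (p + 1) * Gamma (struve_a p b delta) * Rpower x (- p)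
          * struve_W q p b c delta x).
Proof.
intros Hx; unfold struve_g, CSeries, struve_W.
rewrite <- Series_scal_l; apply (f_equal2 (@pair R R)).
- apply Series_ext; intros n.
  rewrite <- RtoC_pow, <- RtoC_mult; unfold Re, RtoC, fst.
  assert (E : Rpower 2 (p + 1) * Rpower x (- p)
              * Rpower (x / 2) (2 * INR n + p + 1)
              = / 4 ^ n * x ^ (2 * n + 1)).
  { replace (4 ^ n) with (2 ^ (2 * n)) by (rewrite pow_mult; f_equal; ring).
    rewrite <- !Rpower_pow by lra.
    rewrite plus_INR, mult_INR, <- Rpower_Ropp.
    change (INR 2) with 2; change (INR 1) with 1.
    unfold Rpower; rewrite ln_div by lra.
    rewrite <- !exp_plus; f_equal; ring. }
  transitivity (Gamma (struve_a p b delta) * struve_coef q p b c delta n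
                * (/ 4 ^ n * x ^ (2 * n + 1))).
  + unfold Rdiv; ring.
  + rewrite <- E; ring.
- rewrite <- (Rmult_0_l (Series (fun _ => 0))), <- Series_scal_l.
  apply Series_ext; intros n.
  rewrite <- RtoC_pow, <- RtoC_mult, Rmult_0_l; reflexivity.
Qed.

(* The condition F'(z) <> 0 makes explicit that the quotient must be defined,
   division being total here.  The supremum is taken in the extended reals.
   C_derive is the complex derivative wherever F is complex differentiable
   (is_C_derive_unique). *)
Definition radius_of_convexity (F : C -> C) : Rbar :=
  Lub_Rbar (fun r : R => 0 < r /\
    forall z : C, Cmod z < r ->
      C_derive F z <> RtoC 0 /\
      0 < Re (RtoC 1 + z * C_derive (C_derive F) z / C_derive F z)%C).

Definition is_smallest_positive_root (h : C -> C) (r : R) : Prop :=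
  0 < r /\ h (RtoC r) = RtoC 0 /\
  forall x : R, 0 < x < r -> h (RtoC x) <> RtoC 0.

(* Main.v *)
Require Import Defs.
From Stdlib Require Import Reals Factorial Lra Lia List PeanoNat Classical.
From Coquelicot Require Import Coquelicot.
Open Scope R_scope.

(* With kappa = c Gamma(a) / (4 Gamma(q + a)) one has g(z) = z F(kappa z^2) for
   an entire F with F(y) = 1 - y + ..., hence g' = G(kappa z^2) and
   (z g')' = H(kappa z^2), where G = (2 theta + 1) F, H = (2 theta + 1) G and
   theta = y d/dy; moreover 1 + z g''/g' = (H / G)(kappa z^2).

   The series of H alternates with decreasing terms, so
   1 - 9 y < H(y) <= 1 - 9 y + 25 beta y^2 / 2 for 0 < y <= 1/6, where
   beta = Gamma(q + a)^2 / (Gamma(a) Gamma(2 q + a)) <= 1.  This puts the first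
   positive zero y0 of H strictly between 1/9 and 9 / (81 - 25 beta) < 1/6.

   Write H / G = 1 - 2 y U(y) with U = - G' / G.  The Taylor coefficients of U
   satisfy Newton's recursion, which is alternating with decreasing terms; it
   gives two-sided bounds on the ratios of consecutive coefficients, and in
   particular their positivity.  Hence Re (H / G)(w) >= (H / G)(|w|) > 0 for
   |w| < y0, and no information on the location of the zeros of G is needed
   beyond G <> 0 on |w| <= 1/6. *)

(** * Newton recursion for the logarithmic derivative *)

(** Peeling off the first term leaves [T 0] minus a sum of the same kind for the shifted sequence,
    which by induction lies between 0 and [T 1 <= T 0]. *)
Lemma alternating_sum_bounds (T : nat -> R) (n : nat) :
  (forall k, (k <= n)%nat -> 0 <= T k) ->
  (forall k, (k < n)%nat -> T (S k) <= T k) ->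
  0 <= sum_f_R0 (fun k => (-1) ^ k * T k) n <= T 0%nat.
Proof.
revert T; induction n as [|n IH]; intros T Hpos Hdec.
- simpl; specialize (Hpos 0%nat (le_n _)); lra.
- rewrite decomp_sum by lia; simpl pred.
  rewrite (sum_eq _ (fun k => (-1) ^ k * T (S k) * (-1)))
    by (intros; simpl; ring).
  rewrite <- scal_sum.
  destruct (IH (fun k => T (S k))) as [H1 H2].
  + intros k Hk; apply Hpos; lia.
  + intros k Hk; apply Hdec; lia.
  + specialize (Hdec 0%nat ltac:(lia)); simpl; lra.
Qed.

Lemma power_series_division (B c : nat -> R) : B 0%nat = 1 ->
  exists u : nat -> R,
    forall n, sum_f_R0 (fun k => B k * u (n - k)%nat) n = c n.
Proof.
intros HB.
(* [tab n] lists [u (n - 1), ..., u 0], latest first. The sum in [next n] runs one index past the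
   end of this list, and the default 0 of [nth] removes that term. *)
pose (next n l := c n - sum_f_R0 (fun k => B (S k) * nth k l 0) n).
pose (tab := fix tab n :=
  match n with O => nil | S n => next n (tab n) :: tab n end).
pose (u n := next n (tab n)); exists u.
assert (Hlen : forall n, length (tab n) = n)
  by (induction n; simpl; congruence).
assert (Hnth : forall n k, (k < n)%nat -> nth k (tab n) 0 = u (n - 1 - k)%nat).
{ induction n as [|n IH]; intros k Hk; [lia|].
  destruct k as [|k]; simpl.
  - now rewrite !Nat.sub_0_r.
  - rewrite IH by lia; f_equal; lia. }
intros [|n].
- simpl; unfold u, next; simpl; rewrite HB; ring.
- rewrite decomp_sum by lia; simpl pred; rewrite HB.
  change (S n - 0)%nat with (S n); unfold u at 1, next.
  rewrite tech5, (nth_overflow (tab (S n)) 0 (n := S n))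
    by (rewrite Hlen; lia).
  rewrite (sum_eq (fun k => B (S k) * nth k (tab (S n)) 0)
                  (fun k => B (S k) * u (S n - S k)%nat)); [ring|].
  intros k Hk; rewrite Hnth by lia; do 2 f_equal; lia.
Qed.

(* The n-th coefficient of F is (-1)^n beta_0 ... beta_(n-1) / n!, with
   beta_n = kappa_n / kappa_0 and kappa_n = Gamma(q n + a) / Gamma(q n + q + a). *)
Record weights (beta : nat -> R) : Prop := {
  weight_0 : beta 0%nat = 1;
  weight_pos : forall n, 0 < beta n;
  weight_decr : forall n, beta (S n) <= beta n;
  weight_2 : beta 1%nat ^ 2 <= beta 2%nat }.

Fixpoint fcoef (beta : nat -> R) (n : nat) : R :=
  match n with
  | O => 1
  | S n => fcoef beta n * beta n / INR (S n)
  end.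

Definition gcoef (beta : nat -> R) (n : nat) : R :=
  (2 * INR n + 1) * fcoef beta n.

Lemma weight_le_1 beta n : weights beta -> beta n <= 1.
Proof.
intros Hb; induction n as [|n IH].
- rewrite weight_0 by trivial; lra.
- generalize (weight_decr _ Hb n); lra.
Qed.

Lemma fcoef_pos beta n : weights beta -> 0 < fcoef beta n.
Proof.
intros Hb; induction n as [|n IH]; [simpl; lra|].
change (0 < fcoef beta n * beta n / INR (S n)).
apply Rdiv_lt_0_compat; [|apply lt_0_INR; lia].
now apply Rmult_lt_0_compat; [|apply weight_pos].
Qed.

Lemma gcoef_pos beta n : weights beta -> 0 < gcoef beta n.
Proof.
intros Hb; apply Rmult_lt_0_compat; [|now apply fcoef_pos].
generalize (pos_INR n); lra.
Qed.

Lemma fcoef_S_le beta n : weights beta ->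
  INR (S n) * fcoef beta (S n) <= fcoef beta n.
Proof.
intros Hb; change (fcoef beta (S n)) with (fcoef beta n * beta n / INR (S n)).
generalize (weight_le_1 _ n Hb) (fcoef_pos _ n Hb).
intros H1 H2; replace (_ * _) with (fcoef beta n * beta n).
- rewrite <- (Rmult_1_r (fcoef beta n)) at 2.
  apply Rmult_le_compat_l; lra.
- field; apply not_0_INR; lia.
Qed.

(** Since [beta <= 1], the quotient of the two coefficients is at most
    [(2 n + 5) / ((2 n + 3) (n + 2))], which is largest at [n = 0], with value 5/6. The second bound
    serves the last two terms of Newton's recursion, where 3 is [u 0]. *)
Lemma gcoef_S_le beta n : weights beta ->
  gcoef beta (S (S n)) <= 5 / 6 * gcoef beta (S n)
  /\ INR (n + 2) * gcoef beta (S (S n)) <= 3 * gcoef beta (S n).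
Proof.
intros Hb; unfold gcoef; generalize (fcoef_S_le _ (S n) Hb).
generalize (fcoef_pos _ (S n) Hb) (fcoef_pos _ (S (S n)) Hb) (pos_INR n).
replace (n + 2)%nat with (S (S n)) by lia; rewrite !S_INR.
generalize (fcoef beta (S (S n))), (fcoef beta (S n)), (INR n).
intros y x N Hx Hy HN H; split.
- assert (E : 0 <= (5 / 6 * (2 * (N + 1) + 1) * (N + 1 + 1) - (2 * (N + 1 + 1) + 1)) * y)
    by (apply Rmult_le_pos; nra).
  assert (E2 : 0 <= 5 / 6 * (2 * (N + 1) + 1) * (x - (N + 1 + 1) * y))
    by (apply Rmult_le_pos; nra).
  nra.
- assert (E : 0 <= (2 * (N + 1 + 1) + 1) * (x - (N + 1 + 1) * y))
    by (apply Rmult_le_pos; nra).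
  nra.
Qed.

(** Induction step for [b >= 9/10]: [w, x, y, z, v] are consecutive coefficients of U, and [v] is
    enclosed by the recursion cut after four and after three terms. The ratio [x / w] may be the
    exceptional first one, for which only the lower bound 4/3 is available. *)
Lemma steep_step (b d e w x y z v : R) :
  9 / 10 <= b -> b <= 1 -> b ^ 3 <= b * d <= b -> 0 <= b * d * e <= b * d ->
  3 * z - 5 / 2 * b * y + 7 / 6 * (b * d) * x - 3 / 8 * (b * d * e) * w <= v ->
  v <= 3 * z - 5 / 2 * b * y + 7 / 6 * (b * d) * x ->
  0 <= w -> 0 <= x -> 0 <= y ->
  4 / 3 * w <= x <= 12 / 5 * w ->
  4 / 3 * x <= y <= 12 / 5 * x ->
  87 / 50 * x <= y <= 12 / 5 * x ->
  87 / 50 * y <= z <= 12 / 5 * y ->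
  87 / 50 * z <= v <= 12 / 5 * z.
Proof.
generalize (b * d * e); intros m; generalize (b * d); intros k.
intros Hb Hb1 Hk Hm H1 H2 Hw Hx Hy Q0 Q Q1 Q2.
split.
- assert (m * w <= k * w) by nra.
  assert (k * w <= k * (3 / 4 * x)) by (apply Rmult_le_compat_l; lra).
  assert (b ^ 3 * x <= k * x) by nra.
  assert (0 <= (5 / 2 * b - 9 / 4) * (12 / 5 * x - y)) by nra.
  (* Here [16443/3125 = 12/5 * 87/50 * (3 - 87/50)], [6 = 12/5 * 5/2] and [85/96 = 7/6 - 3/8 * 3/4].
     Replacing [b ^ 3] by its tangent [3 b - 2] at 1 leaves a decreasing linear function of [b] that
     is still positive at [b = 1]. *)
  assert (P : 0 <= 16443 / 3125 - 6 * b + 85 / 96 * b ^ 3)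
    by (assert (0 <= (b - 1) ^ 2 * (b + 2))
          by (apply Rmult_le_pos; [apply pow2_ge_0|lra]); lra).
  assert (0 <= (16443 / 3125 - 6 * b + 85 / 96 * b ^ 3) * x) by nra.
  lra.
(* With [13/8 = 5/2 - 7/6 * 3/4], the ratio is at most [3 - 13/8 * 9/10 * 5/12], just below 12/5. *)
- assert (k * x <= b * x) by nra.
  assert (b * x <= b * (3 / 4 * y)) by (apply Rmult_le_compat_l; lra).
  assert (9 / 10 * y <= b * y) by nra.
  lra.
Qed.

Section LogDerivative.
Variables (beta u : nat -> R).
Hypothesis Hb : weights beta.
Hypothesis Hu : forall n,
  sum_f_R0 (fun k => (-1) ^ k * gcoef beta k * u (n - k)%nat) n
  = (-1) ^ n * (INR (S n) * gcoef beta (S n)).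

(** Sizes of the terms once the recursion is solved for [u n]; the last one, at [k = n], comes from
    the right-hand side, a coefficient of [- G'] up to sign. *)
Let T (n k : nat) : R :=
  if (k <? n)%nat then gcoef beta (S k) * u (n - 1 - k)%nat
  else INR (S n) * gcoef beta (S n).

Lemma newton_alternating n : u n = sum_f_R0 (fun k => (-1) ^ k * T n k) n.
Proof.
specialize (Hu n); destruct n as [|n].
- revert Hu; unfold T, gcoef; simpl; intros Hu; rewrite <- Hu; ring.
- rewrite decomp_sum in Hu by lia; simpl pred in Hu.
  change (S n - 0)%nat with (S n) in Hu.
  rewrite tech5; unfold T at 2; rewrite Nat.ltb_irrefl, <- Hu.
  rewrite (sum_eq (fun k => (-1) ^ k * T (S n) k)
     (fun k => (-1) ^ (S k) * gcoef beta (S k) * u (S n - S k)%nat * (-1))).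
  2:{ intros k Hk; unfold T; destruct (Nat.ltb_spec k (S n)); [|lia].
      replace (S n - 1 - k)%nat with (S n - S k)%nat by lia; simpl; ring. }
  rewrite <- scal_sum; unfold gcoef at 2; simpl; ring.
Qed.

(** The factor 5/6 between consecutive [gcoef] compensates the factor 6/5 by which [u j] may exceed
    [u (S j)]. The last two terms are compared through [u 0 = 3] and the second bound of
    [gcoef_S_le]. *)
Lemma newton_terms n :
  (forall j, (j <= n)%nat -> 0 <= u j) -> u 0%nat = 3 ->
  (forall j, (j < n)%nat -> 5 / 6 * u j <= u (S j)) ->
  (forall k, 0 <= T (S n) k) /\
  (forall k, (k < S n)%nat -> T (S n) (S k) <= T (S n) k).
Proof.
intros Hpos H0 Hr; split; intros k.
- unfold T; destruct (Nat.ltb_spec k (S n)); apply Rmult_le_pos.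
  + now apply Rlt_le, gcoef_pos.
  + apply Hpos; lia.
  + apply pos_INR.
  + now apply Rlt_le, gcoef_pos.
- intros Hk; unfold T.
  destruct (Nat.ltb_spec k (S n)); [|lia].
  destruct (gcoef_S_le _ k Hb) as [Hg1 Hg2].
  destruct (Nat.ltb_spec (S k) (S n)).
  + specialize (Hr (S n - 1 - S k)%nat ltac:(lia)).
    replace (S (S n - 1 - S k)) with (S n - 1 - k)%nat in Hr by lia.
    assert (0 <= u (S n - 1 - S k)%nat) by (apply Hpos; lia).
    generalize (gcoef_pos _ (S k) Hb) (gcoef_pos _ (S (S k)) Hb); nra.
  + replace k with n in * by lia.
    replace (S n - 1 - n)%nat with 0%nat by lia; rewrite H0.
    replace (n + 2)%nat with (S (S n)) in Hg2 by lia; lra.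
Qed.

Lemma newton_step2 n :
  (forall j, (j <= S n)%nat -> 0 <= u j) -> u 0%nat = 3 ->
  (forall j, (j < S n)%nat -> 5 / 6 * u j <= u (S j)) ->
  3 * u (S n) - gcoef beta 2 * u n <= u (S (S n)) <= 3 * u (S n).
Proof.
intros Hpos H0 Hr; destruct (newton_terms (S n) Hpos H0 Hr) as [HT HT'].
rewrite (newton_alternating (S (S n))).
assert (E1 : T (S (S n)) 0 = 3 * u (S n)).
{ unfold T, gcoef; simpl; rewrite (weight_0 _ Hb); f_equal; field. }
assert (E2 : T (S (S n)) 1 = gcoef beta 2 * u n).
{ unfold T; simpl; do 2 f_equal; lia. }
rewrite decomp_sum by lia; simpl pred.
rewrite (sum_eq _ (fun k => (-1) ^ k * T (S (S n)) (S k) * (-1)))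
  by (intros; simpl; ring).
rewrite <- scal_sum, <- E1, <- E2.
destruct (alternating_sum_bounds (fun k => T (S (S n)) (S k)) (S n)).
- intros; apply HT.
- intros; apply HT'; lia.
- rewrite pow_O; lra.
Qed.

(** Three terms are kept before the alternating tail is estimated by its leading term. That term
    stays unevaluated because it is the boundary term [4 * gcoef beta 4] for [n = 0] and
    [gcoef beta 4 * u (n - 1)] otherwise. *)
Lemma newton_step4 n :
  (forall j, (j <= S (S n))%nat -> 0 <= u j) -> u 0%nat = 3 ->
  (forall j, (j < S (S n))%nat -> 5 / 6 * u j <= u (S j)) ->
  3 * u (S (S n)) - gcoef beta 2 * u (S n) + gcoef beta 3 * u n - T (S (S (S n))) 3
  <= u (S (S (S n)))
  <= 3 * u (S (S n)) - gcoef beta 2 * u (S n) + gcoef beta 3 * u n.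
Proof.
intros Hpos H0 Hr; destruct (newton_terms (S (S n)) Hpos H0 Hr) as [HT HT'].
rewrite (newton_alternating (S (S (S n)))).
assert (E1 : T (S (S (S n))) 0 = 3 * u (S (S n))).
{ unfold T, gcoef; simpl; rewrite (weight_0 _ Hb); f_equal; field. }
assert (E2 : T (S (S (S n))) 1 = gcoef beta 2 * u (S n)) by reflexivity.
assert (E3 : T (S (S (S n))) 2 = gcoef beta 3 * u n).
{ unfold T; simpl; do 2 f_equal; lia. }
rewrite <- E1, <- E2, <- E3.
do 3 (rewrite decomp_sum by lia; simpl pred).
rewrite (sum_eq (fun k => (-1) ^ S (S (S k)) * T (S (S (S n))) (S (S (S k))))
  (fun k => (-1) ^ k * T (S (S (S n))) (S (S (S k))) * (-1)))
  by (intros; simpl; ring).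
rewrite <- scal_sum.
destruct (alternating_sum_bounds (fun k => T (S (S (S n))) (S (S (S k)))) n).
- intros; apply HT.
- intros; apply HT'; lia.
- simpl; lra.
Qed.

Let b := beta 1%nat.
Let d := beta 2%nat.
Let e := beta 3%nat.

Lemma gcoef_small : gcoef beta 1 = 3 /\ gcoef beta 2 = 5 / 2 * b /\
  gcoef beta 3 = 7 / 6 * (b * d) /\ gcoef beta 4 = 3 / 8 * (b * d * e).
Proof.
unfold gcoef, b, d, e; simpl; rewrite (weight_0 _ Hb); repeat split; field.
Qed.

Lemma newton_0 : u 0%nat = 3.
Proof.
rewrite newton_alternating; unfold T; simpl.
rewrite (proj1 gcoef_small); ring.
Qed.

Lemma newton_1 : u 1%nat = 9 - 5 * b.
Proof.
rewrite newton_alternating; unfold T; simpl.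
destruct gcoef_small as (-> & -> & _); rewrite newton_0; field.
Qed.

Lemma newton_2 : u 2%nat = 3 * u 1%nat - 15 / 2 * b + 7 / 2 * (b * d).
Proof.
rewrite newton_alternating; unfold T; simpl.
destruct gcoef_small as (-> & -> & -> & _); rewrite newton_0; field.
Qed.

(* For b <= 9/10 the two-term bound u_(n+2) >= 3 u_(n+1) - (5 b / 2) u_n already
   propagates the ratio 3/2; its characteristic polynomial has no real root for
   b > 9/10, where two more terms of the recursion are needed. *)
Lemma newton_ratio_flat (Hflat : b <= 9 / 10) n :
  (forall j, (j <= S n)%nat -> 0 <= u j) /\
  (forall j, (j < S n)%nat -> 3 / 2 * u j <= u (S j) <= 3 * u j).
Proof.
assert (0 < b) by now apply weight_pos.
induction n as [|n [IH1 IH2]].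
- generalize newton_0 newton_1; intros E0 E1; split.
  + intros [|[|j]] Hj; try lia; lra.
  + intros [|j] Hj; try lia; lra.
- assert (H2 := newton_step2 n IH1 newton_0
    (fun j Hj => ltac:(generalize (IH2 j Hj) (IH1 j ltac:(lia)); lra))).
  rewrite (proj1 (proj2 gcoef_small)) in H2.
  destruct (IH2 n ltac:(lia)) as [H3 _].
  assert (H4 := IH1 n ltac:(lia)).
  (* As [u n <= 2/3 * u (S n)], the lower bound is at least [(3 - 5 b / 3) * u (S n)], and
     [3 - 5 b / 3] equals 3/2 exactly at [b = 9/10]. *)
  assert (H5 : 3 / 2 * u (S n) <= u (S (S n))) by nra.
  split; intros j Hj.
  + destruct (Nat.eq_dec j (S (S n))) as [->|]; [nra|apply IH1; lia].
  + destruct (Nat.eq_dec j (S n)) as [->|]; [lra|apply IH2; lia].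
Qed.

(** The first ratio [(9 - 5 b) / 3] can drop to 4/3, so the range from 87/50 to 12/5 starts with
    [u 2 / u 1]. Since [steep_step] looks back over four terms, the ratios up to [u 3 / u 2] are
    checked directly. *)
Lemma newton_ratio_steep (Hsteep : 9 / 10 <= b) n :
  (forall j, (j <= S (S (S n)))%nat -> 0 <= u j) /\
  4 / 3 * u 0%nat <= u 1%nat <= 12 / 5 * u 0%nat /\
  (forall j, (S j < S (S (S n)))%nat ->
     87 / 50 * u (S j) <= u (S (S j)) <= 12 / 5 * u (S j)).
Proof.
assert (Hb1 : b <= 1) by now apply weight_le_1.
assert (Hdb : d <= b) by now apply weight_decr.
assert (Hed : e <= d) by now apply weight_decr.
assert (He : 0 < e) by now apply weight_pos.
assert (Hd : b ^ 2 <= d) by now apply weight_2.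
assert (Hbd : b ^ 3 <= b * d <= b).
{ split; [replace (b ^ 3) with (b * b ^ 2) by ring|]; nra. }
assert (Hbde : 0 <= b * d * e <= b * d).
{ assert (0 <= b * d) by nra; split; nra. }
destruct gcoef_small as (_ & G2 & G3 & G4).
assert (E0 := newton_0); assert (E1 := newton_1); assert (E2 := newton_2).
assert (R1 : 4 / 3 * u 0%nat <= u 1%nat <= 3 / 2 * u 0%nat) by lra.
assert (R2 : 87 / 50 * u 1%nat <= u 2%nat <= 12 / 5 * u 1%nat).
{ rewrite E2, E1; split; [|lra].
  assert (0 <= 567 / 50 - 69 / 5 * b + 7 / 2 * b ^ 3) by nra; lra. }
assert (R3 : 87 / 50 * u 2%nat <= u 3%nat <= 12 / 5 * u 2%nat).
{ destruct (newton_step4 0) as [H1 H2].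
  - intros [|[|[|j]]] Hj; try lia; lra.
  - exact E0.
  - intros [|[|j]] Hj; try lia; lra.
  - revert H1 H2; unfold T; simpl; rewrite G2, G3, G4, E0.
    generalize (u 3%nat); intros v H1 H2; split.
    (* The boundary term is [4 * gcoef beta 4 = 3/2 * b d e <= 3/2 * b d], so the last two terms
       contribute at least [2 b d >= 2 b ^ 3]; 219/100 is [87/50 * (3 - 87/50)] rounded down. *)
    + assert (0 <= (219 / 100 - 5 / 2 * b) * u 1%nat + 2 * b ^ 3)
        by (rewrite E1; nra); lra.
    + assert (9 / 4 * u 1%nat <= 5 / 2 * b * u 1%nat)
        by (rewrite E1; nra); lra. }
induction n as [|n [IH1 [_ IH2]]].
- split; [|split; [lra|]].
  + intros [|[|[|[|j]]]] Hj; try lia; lra.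
  + intros [|[|j]] Hj; try lia; lra.
- assert (Hlow : forall j, (j < S (S (S n)))%nat ->
    4 / 3 * u j <= u (S j) <= 12 / 5 * u j).
  { intros [|j] Hj; [lra|].
    generalize (IH2 j Hj) (IH1 (S j) ltac:(lia)); lra. }
  assert (HN : 87 / 50 * u (S (S (S n))) <= u (S (S (S (S n))))
               <= 12 / 5 * u (S (S (S n)))).
  { destruct (newton_step4 (S n)) as [H1 H2].
    - intros j Hj; apply IH1; lia.
    - exact E0.
    - intros j Hj; generalize (Hlow j ltac:(lia)) (IH1 j ltac:(lia)); lra.
    - assert (HT : T (S (S (S (S n)))) 3 = gcoef beta 4 * u n).
      { unfold T; simpl; do 2 f_equal; lia. }
      rewrite HT, G2, G3, G4 in H1; rewrite G2, G3 in H2.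
      apply (steep_step b d e (u n) (u (S n)) (u (S (S n))));
        auto; try (apply IH1; lia); try (apply IH2; lia); apply Hlow; lia. }
  split; [|split; [lra|]]; intros j Hj.
  + destruct (Nat.eq_dec j (S (S (S (S n))))) as [->|]; [|apply IH1; lia].
    generalize (IH1 (S (S (S n))) (le_n _)); lra.
  + destruct (Nat.eq_dec j (S (S n))) as [->|]; [lra|apply IH2; lia].
Qed.
End LogDerivative.

(** * Complex power series *)

Definition abs_summable (u : nat -> C) : Prop := ex_series (fun n => Cmod (u n)).

Lemma Rabs_Re_Im_le_Cmod (z : C) : Rabs (Re z) <= Cmod z /\ Rabs (Im z) <= Cmod z.
Proof.
generalize (Rmax_Cmod z); unfold Re, Im; intros H; split;
  (eapply Rle_trans; [|exact H]); [apply Rmax_l|apply Rmax_r].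
Qed.

Lemma abs_summable_Re_Im u : abs_summable u ->
  ex_series (fun n => Rabs (Re (u n))) /\ ex_series (fun n => Rabs (Im (u n))).
Proof.
intros H; split; apply (ex_series_le (V := R_CompleteNormedModule) _ _) with (2 := H);
  intros n; destruct (Rabs_Re_Im_le_Cmod (u n));
  simpl; unfold norm; simpl; unfold abs; simpl; now rewrite Rabs_Rabsolu.
Qed.

Lemma abs_summable_ex_series u : abs_summable u ->
  ex_series (fun n => Re (u n)) /\ ex_series (fun n => Im (u n)).
Proof.
intros H; destruct (abs_summable_Re_Im u H); split; now apply ex_series_Rabs.
Qed.

Lemma abs_summable_le (u : nat -> C) (b : nat -> R) :
  (forall n, Cmod (u n) <= b n) -> ex_series b -> abs_summable u.
Proof.
intros H; apply (ex_series_le (V := R_CompleteNormedModule)); intros n.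
simpl; unfold norm; simpl; unfold abs; simpl.
rewrite Rabs_pos_eq; [apply H|apply Cmod_ge_0].
Qed.

Lemma CSeries_ext u v : (forall n, u n = v n) -> CSeries u = CSeries v.
Proof.
intros H; unfold CSeries; f_equal; apply Series_ext; intros n; now rewrite H.
Qed.

Lemma CSeries_plus u v : abs_summable u -> abs_summable v ->
  CSeries (fun n => u n + v n)%C = (CSeries u + CSeries v)%C.
Proof.
intros Hu Hv; destruct (abs_summable_ex_series u Hu), (abs_summable_ex_series v Hv).
unfold CSeries, Cplus; simpl; rewrite <- !Series_plus by trivial; reflexivity.
Qed.

Lemma CSeries_scal (k : C) u : abs_summable u ->
  CSeries (fun n => k * u n)%C = (k * CSeries u)%C.
Proof.
intros Hu; destruct (abs_summable_ex_series u Hu) as [H1 H2].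
assert (Hs : forall (c : R) a, ex_series a -> ex_series (fun n => c * a n))
  by (intros c a Ha; exact (ex_series_scal_l c a Ha)).
unfold CSeries; rewrite (surjective_pairing (k * _)%C); simpl; f_equal.
- rewrite <- !Series_scal_l, <- Series_minus by now apply Hs.
  apply Series_ext; intros n; unfold Re, Im; simpl; ring.
- rewrite <- !Series_scal_l, <- Series_plus by now apply Hs.
  apply Series_ext; intros n; unfold Re, Im; simpl; ring.
Qed.

Lemma CSeries_incr_1 u : abs_summable u ->
  CSeries u = (u 0%nat + CSeries (fun n => u (S n)))%C.
Proof.
intros Hu; destruct (abs_summable_ex_series u Hu).
unfold CSeries, Cplus; simpl.
now rewrite (Series_incr_1 (fun n => Re (u n))), (Series_incr_1 (fun n => Im (u n))).
Qed.

(** The real part gets the sharp bound, on which the comparison of H / G on circles rests. The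
    modulus is estimated by the sum of both parts, hence the factor 2, which is harmless for
    remainders. *)
Lemma CSeries_bound (u : nat -> C) (b : nat -> R) :
  (forall n, Cmod (u n) <= b n) -> ex_series b ->
  Rabs (Re (CSeries u)) <= Series b /\ Cmod (CSeries u) <= 2 * Series b.
Proof.
intros H Hb; assert (Hu := abs_summable_le u b H Hb).
destruct (abs_summable_Re_Im u Hu) as [H1 H2].
assert (R1 : Rabs (Re (CSeries u)) <= Series b).
{ eapply Rle_trans; [now apply Series_Rabs|].
  apply Series_le; trivial; intros n; split; [apply Rabs_pos|].
  eapply Rle_trans; [apply Rabs_Re_Im_le_Cmod|apply H]. }
assert (R2 : Rabs (Im (CSeries u)) <= Series b).
{ eapply Rle_trans; [now apply Series_Rabs|].
  apply Series_le; trivial; intros n; split; [apply Rabs_pos|].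
  eapply Rle_trans; [apply Rabs_Re_Im_le_Cmod|apply H]. }
split; trivial.
replace (CSeries u) with (RtoC (Re (CSeries u)) + Ci * RtoC (Im (CSeries u)))%C
  by (unfold CSeries, Ci, RtoC, Cplus, Cmult, Re, Im; simpl; f_equal; ring).
eapply Rle_trans; [apply Cmod_triangle|].
assert (E : Cmod Ci = 1).
{ rewrite <- sqrt_1; unfold Cmod, Ci; f_equal; simpl; ring. }
rewrite Cmod_mult, !Cmod_R, E; lra.
Qed.

Definition Cconv (u v : nat -> C) (n : nat) : C :=
  (sum_f_R0 (fun k => Re (u k * v (n - k)%nat)) n,
   sum_f_R0 (fun k => Im (u k * v (n - k)%nat)) n)%C.

(* The Cauchy product of complex series, reduced to real ones by splitting
   into real and imaginary parts. *)
Lemma CSeries_mult u v : abs_summable u -> abs_summable v ->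
  CSeries (Cconv u v) = (CSeries u * CSeries v)%C.
Proof.
intros Hu Hv.
destruct (abs_summable_Re_Im u Hu) as [Ur Ui], (abs_summable_Re_Im v Hv) as [Vr Vi].
assert (P : forall a b, ex_series (fun n => Rabs (a n)) ->
  ex_series (fun n => Rabs (b n)) ->
  is_series (fun n => sum_f_R0 (fun k => a k * b (n - k)%nat) n) (Series a * Series b)).
{ intros a b Ha Hb; apply is_series_mult; trivial;
    now apply Series_correct, ex_series_Rabs. }
unfold CSeries, Cmult, Cconv; simpl; f_equal; apply is_series_unique.
- eapply is_series_ext; [|apply (is_series_minus _ _ _ _ (P _ _ Ur Vr) (P _ _ Ui Vi))].
  intros n; simpl; unfold plus, opp; simpl.
  fold (Rminus (sum_f_R0 (fun k => Re (u k) * Re (v (n - k)%nat)) n)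
    (sum_f_R0 (fun k => Im (u k) * Im (v (n - k)%nat)) n)).
  rewrite <- minus_sum; apply sum_eq; intros i _; unfold Re, Im; simpl; ring.
- eapply is_series_ext; [|apply (is_series_plus _ _ _ _ (P _ _ Ur Vi) (P _ _ Ui Vr))].
  intros n; simpl; unfold plus; simpl.
  rewrite <- sum_plus; apply sum_eq; intros i _; unfold Re, Im; simpl; ring.
Qed.

Definition CPSeries (A : nat -> R) (z : C) : C :=
  CSeries (fun n => RtoC (A n) * z ^ n)%C.

Definition abs_summable_at (A : nat -> R) (r : R) : Prop :=
  ex_series (fun n => Rabs (A n) * r ^ n).

Definition entire (A : nat -> R) : Prop :=
  forall r, 0 <= r -> abs_summable_at A r.

Lemma CPSeries_summable A z : abs_summable_at A (Cmod z) ->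
  abs_summable (fun n => RtoC (A n) * z ^ n)%C.
Proof.
apply abs_summable_le; intros n.
rewrite Cmod_mult, Cmod_R, Cmod_pow; lra.
Qed.

Lemma CPSeries_R A (x : R) : CPSeries A (RtoC x) = RtoC (PSeries A x).
Proof.
unfold CPSeries; rewrite (CSeries_ext _ (fun n => RtoC (A n * x ^ n)))
  by (intros n; now rewrite RtoC_mult, RtoC_pow).
unfold CSeries, PSeries; simpl; apply (f_equal (pair _)).
transitivity (0 * Series (fun _ => 0)); [|ring].
rewrite <- Series_scal_l; apply Series_ext; intros n.
unfold Im, RtoC; simpl; ring.
Qed.

Lemma CPSeries_mult A B D z :
  (forall n, sum_f_R0 (fun k => A k * B (n - k)%nat) n = D n) ->
  abs_summable_at A (Cmod z) -> abs_summable_at B (Cmod z) ->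
  CPSeries D z = (CPSeries A z * CPSeries B z)%C.
Proof.
intros HD HA HB; unfold CPSeries.
rewrite <- CSeries_mult by now apply CPSeries_summable.
apply CSeries_ext; intros n.
assert (E : forall k, (k <= n)%nat ->
  (RtoC (A k) * z ^ k * (RtoC (B (n - k)%nat) * z ^ (n - k)))%C
  = (RtoC (A k * B (n - k)%nat) * z ^ n)%C).
{ intros k Hk; replace (z ^ n)%C with (z ^ k * z ^ (n - k))%C
    by (rewrite <- Cpow_add_r; f_equal; lia).
  rewrite RtoC_mult; ring. }
rewrite <- HD; apply injective_projections.
- change (Re (RtoC (sum_f_R0 (fun k => A k * B (n - k)%nat)%R n) * z ^ n)%C
    = sum_f_R0 (fun k => Re (RtoC (A k) * z ^ k
                              * (RtoC (B (n - k)%nat) * z ^ (n - k)))%C) n).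
  rewrite re_scal_l, Rmult_comm, scal_sum.
  apply sum_eq; intros k Hk; now rewrite E, re_scal_l by trivial.
- change (Im (RtoC (sum_f_R0 (fun k => A k * B (n - k)%nat)%R n) * z ^ n)%C
    = sum_f_R0 (fun k => Im (RtoC (A k) * z ^ k
                              * (RtoC (B (n - k)%nat) * z ^ (n - k)))%C) n).
  rewrite im_scal_l, Rmult_comm, scal_sum.
  apply sum_eq; intros k Hk; now rewrite E, im_scal_l by trivial.
Qed.

(** * Complex differentiation of entire power series *)

(** The remainders satisfy [E_(n+1) = (z + h) E_n + (n + 1) z^n h^2], where [E_n] belongs to the
    power [n + 1]; the induction closes because [m^2 + m <= (m + 1)^2]. The assumption [1 <= r] lets
    powers of [r] grow with the exponent. *)
Lemma Cmod_pow_increment (z h : C) (r : R) (n : nat) :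
  1 <= r -> Cmod z <= r -> Cmod (z + h)%C <= r ->
  Cmod ((z + h) ^ S n - z ^ S n - RtoC (INR (S n)) * z ^ n * h)%C
  <= (INR (S n)) ^ 2 * r ^ S n * Cmod h ^ 2.
Proof.
intros Hr Hz Hzh; assert (Hh := Cmod_ge_0 h).
induction n as [|n IH].
- replace (_ - _)%C with (RtoC 0) by (simpl; ring).
  rewrite Cmod_0; simpl; nra.
- set (E := ((z + h) ^ S n - z ^ S n - RtoC (INR (S n)) * z ^ n * h)%C) in IH.
  replace (_ - _)%C with ((z + h) * E + RtoC (INR (S n)) * z ^ n * (h * h))%C.
  2:{ unfold E; rewrite (S_INR (S n)), RtoC_plus, !Cpow_S; ring. }
  eapply Rle_trans; [apply Cmod_triangle|].
  rewrite !Cmod_mult, Cmod_R, Cmod_pow.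
  assert (Hn : 1 <= INR (S n)) by (rewrite S_INR; generalize (pos_INR n); lra).
  rewrite Rabs_pos_eq by lra.
  assert (H1 : Cmod z ^ n <= r ^ n)
    by (apply pow_incr; split; [apply Cmod_ge_0|lra]).
  assert (H2 : r ^ n <= r ^ S (S n)) by (apply Rle_pow; [lra|lia]).
  assert (H0 : 0 <= Cmod z ^ n) by (apply pow_le, Cmod_ge_0).
  assert (H3 : Cmod (z + h)%C * Cmod E <= r * (INR (S n) ^ 2 * r ^ S n * Cmod h ^ 2)).
  { apply Rmult_le_compat; try apply Cmod_ge_0; trivial. }
  assert (H4 : INR (S n) * Cmod z ^ n * (Cmod h * Cmod h)
     <= INR (S n) * r ^ S (S n) * (Cmod h * Cmod h)) .
  { apply Rmult_le_compat_r; [nra|apply Rmult_le_compat_l; lra]. }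
  rewrite (S_INR (S n)).
  replace (r * (INR (S n) ^ 2 * r ^ S n * Cmod h ^ 2))
    with (INR (S n) ^ 2 * (r ^ S (S n) * (Cmod h * Cmod h))) in H3 by (simpl; ring).
  assert (0 <= r ^ S (S n) * (Cmod h * Cmod h)) by nra.
  revert H3 H4; generalize (Cmod (z + h)%C * Cmod E); intros x H3 H4.
  simpl (Cmod h ^ 2); rewrite Rmult_1_r.
  nra.
Qed.

Lemma INR_le_pow2 n : INR n <= 2 ^ n.
Proof.
induction n as [|n IH]; [simpl; lra|rewrite S_INR; simpl].
assert (1 <= 2 ^ n) by (apply pow_R1_Rle; lra); lra.
Qed.

Lemma ex_series_le_pos (a b : nat -> R) :
  (forall n, 0 <= a n <= b n) -> ex_series b -> ex_series a.
Proof.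
intros H; apply (ex_series_le (V := R_CompleteNormedModule)); intros n.
change (Rabs (a n) <= b n); rewrite Rabs_pos_eq; apply H.
Qed.

Lemma ex_series_tail (a : nat -> R) :
  ex_series a -> ex_series (fun n => a (S n)).
Proof. intros H; exact (proj1 (ex_series_incr_1 a) H). Qed.

(** As [n^2 <= 4^n], the series at [r] is dominated by the original one at [4 r]. *)
Lemma entire_mult_sqr A r : entire A -> 0 <= r ->
  ex_series (fun n => Rabs (A n) * (INR n ^ 2 * r ^ n)).
Proof.
intros HA Hr; apply ex_series_le_pos with (2 := HA (4 * r) ltac:(lra)).
intros n; rewrite Rpow_mult_distr.
assert (H0 := pow_le r n Hr); assert (H1 := Rabs_pos (A n)).
assert (H2 := INR_le_pow2 n); assert (H3 := pos_INR n).
assert (E : 4 ^ n = 2 ^ n * 2 ^ n) by (rewrite <- Rpow_mult_distr; f_equal; ring).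
assert (H4 : 0 <= INR n ^ 2) by apply pow2_ge_0.
split; [apply Rmult_le_pos; [|apply Rmult_le_pos]; trivial|].
apply Rmult_le_compat_l; [trivial|].
apply Rmult_le_compat_r; [trivial|].
rewrite E; simpl; rewrite Rmult_1_r; now apply Rmult_le_compat.
Qed.

Lemma entire_scal_poly A (w : nat -> R) : entire A ->
  (forall n, Rabs (w n) <= (2 * INR n + 1) ^ 2) -> entire (fun n => w n * A n).
Proof.
intros HA Hw r Hr; unfold abs_summable_at.
apply ex_series_le_pos
  with (fun n => 8 * (Rabs (A n) * (INR n ^ 2 * r ^ n)) + 2 * (Rabs (A n) * r ^ n)).
- intros n; rewrite Rabs_mult.
  assert (H0 := pow_le r n Hr); assert (H1 := Rabs_pos (A n)).
  assert (H : 0 <= Rabs (A n) * r ^ n) by now apply Rmult_le_pos.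
  split; [apply Rmult_le_pos; [apply Rmult_le_pos; [apply Rabs_pos|]|]; trivial|].
  replace (8 * _ + _) with ((8 * INR n ^ 2 + 2) * (Rabs (A n) * r ^ n)) by ring.
  rewrite Rmult_assoc; apply Rmult_le_compat_r; [trivial|].
  (* [8 n^2 + 2 - (2 n + 1)^2 = (2 n - 1)^2]. *)
  specialize (Hw n); generalize (pow2_ge_0 (2 * INR n - 1)); lra.
- apply (ex_series_plus (V := R_NormedModule)).
  + apply (ex_series_scal_l (V := R_NormedModule) 8); now apply entire_mult_sqr.
  + apply (ex_series_scal_l (V := R_NormedModule) 2); now apply HA.
Qed.

Lemma entire_PS_derive A : entire A -> entire (PS_derive A).
Proof.
intros HA r Hr; unfold abs_summable_at.
apply ex_series_le_pos
  with (fun n => Rabs (A (S n)) * (INR (S n) ^ 2 * (r + 1) ^ S n)).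
- intros n; unfold PS_derive; rewrite Rabs_mult.
  rewrite (Rabs_pos_eq (INR (S n))) by apply pos_INR.
  assert (H0 := pow_le r n Hr); assert (H1 := Rabs_pos (A (S n))).
  assert (H2 : r ^ n <= (r + 1) ^ n) by (apply pow_incr; lra).
  assert (H3 : 1 <= INR (S n)) by (rewrite S_INR; generalize (pos_INR n); lra).
  split; [apply Rmult_le_pos; [apply Rmult_le_pos|]; lra|].
  replace (INR (S n) * Rabs (A (S n)) * r ^ n)
    with (Rabs (A (S n)) * (INR (S n) * r ^ n)) by ring.
  apply Rmult_le_compat_l; [trivial|].
  assert (H4 : INR (S n) <= INR (S n) ^ 2) by nra.
  assert (H5 : (r + 1) ^ n <= (r + 1) ^ S n) by (apply Rle_pow; [lra|lia]).
  apply Rmult_le_compat; lra.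
- apply (ex_series_tail (fun n => Rabs (A n) * (INR n ^ 2 * (r + 1) ^ n))).
  apply entire_mult_sqr; [trivial|lra].
Qed.

(** The constant terms cancel and the rest combines into one series, whose terms
    [Cmod_pow_increment] bounds quadratically in [h]. *)
Lemma CPSeries_increment A (z h : C) (r : R) : entire A ->
  1 <= r -> Cmod z <= r -> Cmod (z + h)%C <= r ->
  Cmod (CPSeries A (z + h)%C - CPSeries A z - h * CPSeries (PS_derive A) z)%C
  <= 2 * Series (fun n => Rabs (A (S n)) * (INR (S n) ^ 2 * r ^ S n)) * Cmod h ^ 2.
Proof.
intros HA Hr Hz Hzh.
assert (S1 := CPSeries_summable A (z + h)%C (HA _ (Cmod_ge_0 _))).
assert (S2 := CPSeries_summable A z (HA _ (Cmod_ge_0 _))).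
assert (S3 := CPSeries_summable _ z (entire_PS_derive A HA _ (Cmod_ge_0 z))).
assert (S4 : ex_series (fun n => Rabs (A (S n)) * (INR (S n) ^ 2 * r ^ S n))).
{ apply (ex_series_tail (fun n => Rabs (A n) * (INR n ^ 2 * r ^ n))).
  apply entire_mult_sqr; [trivial|lra]. }
assert (Ssc : forall (k : C) u, abs_summable u -> abs_summable (fun n => k * u n)%C).
{ intros k u Hu; apply abs_summable_le with (fun n => Cmod k * Cmod (u n)).
  - intros n; rewrite Cmod_mult; lra.
  - exact (ex_series_scal_l (V := R_NormedModule) (Cmod k) _ Hu). }
assert (Spl : forall u v, abs_summable u -> abs_summable v ->
   abs_summable (fun n => u n + v n)%C).
{ intros u v Hu Hv; apply abs_summable_le with (fun n => Cmod (u n) + Cmod (v n)).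
  - intros n; apply Cmod_triangle.
  - exact (ex_series_plus (V := R_NormedModule) _ _ Hu Hv). }
unfold CPSeries at 1 2.
rewrite (CSeries_incr_1 _ S1), (CSeries_incr_1 _ S2).
apply ex_series_tail in S1; apply ex_series_tail in S2.
set (u1 := fun n => (RtoC (A (S n)) * (z + h) ^ S n)%C) in *.
set (u2 := fun n => (RtoC (A (S n)) * z ^ S n)%C) in *.
set (u3 := fun n => (RtoC (PS_derive A n) * z ^ n)%C) in *.
unfold CPSeries; fold u3.
replace (_ - _)%C with (CSeries (fun n => u1 n + (- (1) * u2 n + (- h) * u3 n))%C).
2:{ rewrite !CSeries_plus, !CSeries_scal; auto.
    replace (RtoC (A 0%nat) * (z + h) ^ 0)%C with (RtoC (A 0%nat) * z ^ 0)%C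
      by (simpl; ring). ring. }
replace (2 * _ * _) with
  (2 * Series (fun n => Rabs (A (S n)) * (INR (S n) ^ 2 * r ^ S n) * Cmod h ^ 2))
  by (rewrite Series_scal_r; ring).
apply CSeries_bound.
- intros n; replace (_ + _)%C with
    (RtoC (A (S n)) * ((z + h) ^ S n - z ^ S n - RtoC (INR (S n)) * z ^ n * h))%C
    by (unfold u1, u2, u3, PS_derive; rewrite RtoC_mult; ring).
  rewrite Cmod_mult, Cmod_R, Rmult_assoc.
  apply Rmult_le_compat_l; [apply Rabs_pos|].
  now apply Cmod_pow_increment.
- exact (ex_series_scal_r (Cmod h ^ 2) _ S4).
Qed.

Lemma CPSeries_is_derive A (z : C) : entire A ->
  is_derive (K := C_AbsRing) (V := C_NormedModule)
    (CPSeries A) z (CPSeries (PS_derive A) z).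
Proof.
intros HA; split; [apply is_linear_scal_l|].
intros x Hx.
apply (is_filter_lim_locally_unique (V := AbsRing_NormedModule C_AbsRing)) in Hx.
subst x.
intros eps; assert (Hz := Cmod_ge_0 z).
set (r := Cmod z + 1).
set (M := Series (fun n => Rabs (A (S n)) * (INR (S n) ^ 2 * r ^ S n))).
assert (HM : 0 <= M).
{ apply Rle_trans with (2 * M * 0); [lra|].
  rewrite Rmult_0_r; unfold M.
  rewrite <- (Rmult_0_l (Series (fun _ => 0))), <- Series_scal_l.
  apply Series_le.
  - intros n; split; [lra|]; rewrite Rmult_0_l.
    repeat apply Rmult_le_pos; try apply Rabs_pos; try apply pow_le;
      try apply pos_INR; unfold r; lra.
  - apply (ex_series_tail (fun n => Rabs (A n) * (INR n ^ 2 * r ^ n))).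
    apply entire_mult_sqr; [trivial|unfold r; lra]. }
(* The 1 keeps [z + h] in the disc of radius [r]; the denominator [2 M + 1], rather than [2 M],
   stays positive when [M = 0]. *)
assert (Hd : 0 < Rmin 1 (eps / (2 * M + 1))).
{ apply Rmin_pos; [lra|apply Rdiv_lt_0_compat; [apply cond_pos|lra]]. }
exists (mkposreal _ Hd); intros y Hy.
change (Cmod (y - z)%C < Rmin 1 (eps / (2 * M + 1))) in Hy.
change (Cmod (CPSeries A y - CPSeries A z - (y - z) * CPSeries (PS_derive A) z)%C
        <= eps * Cmod (y - z)%C).
set (h := (y - z)%C) in *; replace y with (z + h)%C by (unfold h; ring).
assert (H1 : Cmod h < 1) by (eapply Rlt_le_trans; [exact Hy|apply Rmin_l]).
assert (H2 : Cmod h < eps / (2 * M + 1))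
  by (eapply Rlt_le_trans; [exact Hy|apply Rmin_r]).
eapply Rle_trans.
{ apply (CPSeries_increment A z h r); unfold r; try lra; trivial.
  eapply Rle_trans; [apply Cmod_triangle|lra]. }
fold M; assert (H3 : (2 * M + 1) * Cmod h <= eps).
{ apply Rmult_lt_compat_l with (r := 2 * M + 1) in H2; [|lra].
  replace ((2 * M + 1) * (eps / (2 * M + 1))) with (pos eps) in H2 by (field; lra).
  lra. }
generalize (Cmod_ge_0 h); nra.
Qed.

(** * The functions G and H on the disc of radius 1/6 *)

(** [r] is the supremum of the [x] in [[0, Y]] with [f] positive on all of [[0, x]]. By continuity,
    [f r < 0] would contradict positivity before [r], and [f r > 0] would allow a larger [x]. *)
Lemma first_zero (f : R -> R) (Y : R) : (forall x, continuous f x) ->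
  0 <= Y -> 0 < f 0 -> f Y <= 0 ->
  exists r, 0 < r <= Y /\ f r = 0 /\ forall x, 0 <= x < r -> 0 < f x.
Proof.
intros Hf HY H0 HfY.
pose (E := fun x => 0 <= x <= Y /\ forall t, 0 <= t <= x -> 0 < f t).
destruct (completeness E) as [r [Hub Hlub]].
- exists Y; intros x Hx; apply Hx.
- exists 0; split; [lra|]; intros t Ht; now replace t with 0 by lra.
- assert (Hr0 : 0 <= r).
  { apply Hub; split; [lra|]; intros t Ht; now replace t with 0 by lra. }
  assert (HrY : r <= Y) by (apply Hlub; intros x Hx; apply Hx).
  assert (Hpos : forall t, 0 <= t < r -> 0 < f t).
  { intros t Ht; apply Rnot_le_lt; intros Hft.
    assert (r <= t); [|lra].
    apply Hlub; intros x Hx; apply Rnot_lt_le; intros Hlt.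
    apply (Rlt_irrefl 0), Rlt_le_trans with (f t); [apply Hx; lra|trivial]. }
  assert (Hfr : f r = 0).
  { destruct (Rtotal_order (f r) 0) as [Hneg|[Hz|Hp]]; trivial; exfalso.
    - destruct (Hf r _ (open_lt 0 (f r) Hneg)) as [d Hd].
      assert (r <> 0) by (intros ->; lra).
      assert (Hdp := cond_pos d).
      assert (Hm : 0 <= Rmax 0 (r - d / 2) < r)
        by (unfold Rmax; destruct Rle_dec; lra).
      specialize (Hd (Rmax 0 (r - d / 2))).
      assert (Hb : ball r d (Rmax 0 (r - d / 2))).
      { change (Rabs (Rmax 0 (r - d / 2) - r) < d); apply Rabs_def1; [lra|].
        generalize (Rmax_r 0 (r - d / 2)); lra. }
      specialize (Hd Hb); specialize (Hpos _ Hm); simpl in Hd; lra.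
    - destruct (Hf r _ (open_gt 0 (f r) Hp)) as [d Hd].
      assert (Hdp := cond_pos d).
      assert (r <> Y) by (intros ->; lra).
      assert (HE : E (Rmin Y (r + d / 2))).
      { split; [unfold Rmin; destruct Rle_dec; lra|].
        intros t Ht; destruct (Rlt_le_dec t r); [apply Hpos; lra|].
        apply (Hd t); change (Rabs (t - r) < d); apply Rabs_def1; [|lra].
        generalize (Rmin_r Y (r + d / 2)); lra. }
      apply Hub in HE; revert HE; unfold Rmin; destruct Rle_dec; lra. }
  exists r; repeat split; trivial.
  destruct Hr0 as [|<-]; [trivial|lra].
Qed.

Lemma entire_CV_radius A x : entire A -> Rbar_lt (Rabs x) (CV_radius A).
Proof.
intros HA; apply Rbar_not_le_lt; intros Hle.
apply (CV_disk_outside A (Rabs x + 1)).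
- rewrite Rabs_pos_eq by (generalize (Rabs_pos x); lra).
  eapply Rbar_le_lt_trans; [exact Hle|simpl; lra].
- apply ex_series_lim_0, ex_series_Rabs.
  eapply ex_series_ext; [|exact (HA (Rabs x + 1) ltac:(generalize (Rabs_pos x); lra))].
  intros n; simpl; rewrite Rabs_mult, (Rabs_pos_eq (_ ^ _)); [trivial|].
  apply pow_le; generalize (Rabs_pos x); lra.
Qed.

Lemma entire_continuous A x : entire A -> continuous (PSeries A) x.
Proof.
intros HA; apply continuity_pt_filterlim, PSeries_continuity.
now apply entire_CV_radius.
Qed.

Lemma entire_ex_series A x : entire A -> ex_series (fun n => A n * x ^ n).
Proof.
intros HA; apply ex_series_Rabs, CV_disk_inside; now apply entire_CV_radius.
Qed.

Lemma series_alternating_bounds (T : nat -> R) :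
  (forall k, 0 <= T k) -> (forall k, T (S k) <= T k) ->
  ex_series (fun k => (-1) ^ k * T k) ->
  0 <= Series (fun k => (-1) ^ k * T k) <= T 0%nat.
Proof.
intros Hpos Hdec Hs; apply Series_correct in Hs.
assert (Hn : forall n, 0 <= sum_n (fun k => (-1) ^ k * T k) n <= T 0%nat).
{ intros n; rewrite sum_n_Reals; apply alternating_sum_bounds; auto. }
split.
- refine (is_lim_seq_le (fun _ => 0) _ 0 (Finite _) _ (is_lim_seq_const 0) Hs).
  intros n; apply Hn.
- refine (is_lim_seq_le _ (fun _ => T 0%nat) (Finite _) (T 0%nat) _ Hs
    (is_lim_seq_const _)).
  intros n; apply Hn.
Qed.

(** The operator [2 y d/dy + 1] on coefficients, which the overview writes as 2 theta + 1 with theta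
    = y d/dy. Differentiating [z A(k z^2)] in [z] replaces [A] by [theta A]. *)
Definition theta (A : nat -> R) (n : nat) : R := (2 * INR n + 1) * A n.

Lemma entire_theta A : entire A -> entire (theta A).
Proof.
intros HA; apply entire_scal_poly; trivial; intros n.
generalize (pos_INR n); intros H; rewrite Rabs_pos_eq; nra.
Qed.

Lemma CPSeries_theta A z : entire A ->
  CPSeries (theta A) z
  = (CPSeries A z + RtoC 2 * (z * CPSeries (PS_derive A) z))%C.
Proof.
intros HA.
assert (HN : entire (fun n => INR n * A n)).
{ apply entire_scal_poly; trivial; intros n.
  generalize (pos_INR n); intros H; rewrite Rabs_pos_eq; nra. }
assert (S1 := CPSeries_summable _ z (HA _ (Cmod_ge_0 z))).
assert (S2 := CPSeries_summable _ z (HN _ (Cmod_ge_0 z))).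
assert (S3 := CPSeries_summable _ z (entire_PS_derive A HA _ (Cmod_ge_0 z))).
assert (E : (z * CPSeries (PS_derive A) z)%C = CPSeries (fun n => INR n * A n)%R z).
{ unfold CPSeries at 2; rewrite CSeries_incr_1 by trivial.
  unfold CPSeries; rewrite <- CSeries_scal by trivial; simpl INR at 1.
  rewrite Rmult_0_l, Cmult_0_l, Cplus_0_l; apply CSeries_ext; intros n.
  unfold PS_derive; rewrite Cpow_S; ring. }
rewrite E; unfold CPSeries; rewrite <- (CSeries_scal (RtoC 2)) by trivial.
rewrite <- CSeries_plus; trivial.
- apply CSeries_ext; intros n; unfold theta.
  rewrite !RtoC_mult, RtoC_plus, RtoC_mult; ring.
- apply abs_summable_le
    with (fun n => 2 * Cmod (RtoC (INR n * A n) * z ^ n)%C).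
  + intros n; rewrite Cmod_mult, Cmod_R, Rabs_pos_eq; lra.
  + exact (ex_series_scal_l (V := R_NormedModule) 2 _ S2).
Qed.

Definition alt (a : nat -> R) (n : nat) : R := (-1) ^ n * a n.

Lemma Rabs_alt a n : 0 <= a n -> Rabs (alt a n) = a n.
Proof.
intros H; unfold alt; rewrite Rabs_mult, pow_1_abs, Rmult_1_l.
now apply Rabs_pos_eq.
Qed.

Section Core.
Variable beta : nat -> R.
Hypothesis Hb : weights beta.
Let F := alt (fcoef beta).
Let G := theta F.
Let H := theta G.
Let b := beta 1%nat.

Lemma G_gcoef n : G n = alt (gcoef beta) n.
Proof. unfold G, F, theta, alt, gcoef; ring. Qed.

Lemma fcoef_le_inv_fact n : fcoef beta n <= / INR (fact n).
Proof.
induction n as [|n IH]; [simpl; lra|].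
assert (H1 := fcoef_S_le beta n Hb).
assert (H2 : 0 < INR (S n)) by (apply lt_0_INR; lia).
rewrite fact_simpl, mult_INR, Rinv_mult.
apply Rmult_le_reg_l with (INR (S n)); [trivial|].
rewrite <- Rmult_assoc, Rinv_r, Rmult_1_l by lra; lra.
Qed.

Lemma entire_F : entire F.
Proof.
intros r Hr; unfold abs_summable_at.
apply ex_series_le_pos with (fun n => / INR (fact n) * r ^ n).
- intros n; unfold F; rewrite Rabs_alt by now apply Rlt_le, fcoef_pos.
  assert (H0 := pow_le r n Hr); assert (H1 := fcoef_pos beta n Hb).
  split; [apply Rmult_le_pos; lra|].
  apply Rmult_le_compat_r; [trivial|apply fcoef_le_inv_fact].
- exists (exp r); generalize (is_exp_Reals r); intros He.
  eapply is_series_ext; [|exact He]; intros n; simpl.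
  rewrite pow_n_pow; unfold scal; simpl; unfold mult; simpl; ring.
Qed.

Lemma entire_G : entire G.
Proof. apply entire_theta, entire_F. Qed.

Lemma entire_H : entire H.
Proof. apply entire_theta, entire_G. Qed.

(** Beyond [1 - 9 y] the series alternates and its terms at least halve: crudely, the coefficients
    at most double while [y <= 1/6]. The remainder thus lies between 0 and its first term
    [25/2 * b * y^2]. *)
Lemma PSeries_H_bounds (y : R) : 0 < y <= 1 / 6 ->
  1 - 9 * y < PSeries H y <= 1 - 9 * y + 25 / 2 * b * y ^ 2.
Proof.
intros Hy.
pose (c := fun n => (2 * INR n + 1) * gcoef beta n).
assert (Hc : forall n, 0 < c n).
{ intros n; apply Rmult_lt_0_compat; [|now apply gcoef_pos].
  generalize (pos_INR n); lra. }
pose (T := fun n => c (S (S n)) * y ^ S (S n)).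
assert (HT : forall n, 0 < T n).
{ intros n; apply Rmult_lt_0_compat; [apply Hc|now apply pow_lt]. }
assert (HTd : forall n, T (S n) <= 1 / 2 * T n).
{ intros n; unfold T.
  destruct (gcoef_S_le beta (S n) Hb) as [H1 _].
  assert (H2 : c (S (S (S n))) <= 2 * c (S (S n))).
  { unfold c; assert (H3 := gcoef_pos beta (S (S n)) Hb).
    assert (H4 := gcoef_pos beta (S (S (S n))) Hb).
    rewrite !S_INR in *; generalize (pos_INR n); nra. }
  assert (H3 : 0 < y ^ S (S n)) by now apply pow_lt.
  change (y ^ S (S (S n))) with (y * y ^ S (S n)).
  replace (1 / 2 * (c (S (S n)) * y ^ S (S n)))
    with (1 / 2 * c (S (S n)) * y ^ S (S n)) by ring.
  rewrite <- Rmult_assoc; apply Rmult_le_compat_r; [lra|].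
  specialize (Hc (S (S n))); nra. }
assert (HHc : forall n, H n = alt c n)
  by (intros n; unfold H, theta; rewrite G_gcoef; unfold alt, c; ring).
assert (Hex := entire_ex_series _ y entire_H).
assert (Hex2 : ex_series (fun n => (-1) ^ n * T n)).
{ apply ex_series_tail, ex_series_tail in Hex.
  eapply ex_series_ext; [|exact Hex]; intros n; simpl.
  rewrite HHc; unfold alt, T; simpl; ring. }
assert (E : PSeries H y = 1 - 9 * y + Series (fun n => (-1) ^ n * T n)).
{ unfold PSeries; rewrite Series_incr_1 by trivial.
  rewrite Series_incr_1 by now apply ex_series_tail in Hex.
  rewrite (Series_ext (fun k => H (S (S k)) * _) (fun n => (-1) ^ n * T n)).
  - rewrite !HHc; unfold alt, c, gcoef; simpl; rewrite (weight_0 _ Hb); field.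
  - intros n; rewrite HHc; unfold alt, T; simpl; ring. }
assert (HT0 : T 0%nat = 25 / 2 * b * y ^ 2).
{ unfold T, c, gcoef, b; simpl; rewrite (weight_0 _ Hb); field. }
rewrite E, <- HT0.
assert (B0 : 0 <= Series (fun n => (-1) ^ n * T n) <= T 0%nat).
{ apply series_alternating_bounds; trivial; intros n; [now apply Rlt_le|].
  specialize (HTd n); specialize (HT n); lra. }
(* One more term makes the lower bound strict: the remainder is at least
   [T 0 - T 1 >= T 0 / 2 > 0]. *)
assert (B1 : 0 <= Series (fun n => (-1) ^ n * T (S n)) <= T 1%nat).
{ apply (series_alternating_bounds (fun n => T (S n))).
  - intros n; now apply Rlt_le.
  - intros n; specialize (HTd (S n)); specialize (HT (S n)); lra.
  - apply ex_series_tail, (ex_series_scal_l (V := R_NormedModule) (-1)) in Hex2.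
    eapply ex_series_ext; [|exact Hex2]; intros n; unfold scal; simpl.
    unfold mult; simpl; ring. }
rewrite Series_incr_1 in B0 |- * by trivial.
rewrite (Series_ext (fun n => (-1) ^ S n * T (S n))
   (fun n => -1 * ((-1) ^ n * T (S n)))) in B0 |- * by (intros; simpl; ring).
rewrite Series_scal_l in B0 |- *.
specialize (HTd 0%nat); specialize (HT 0%nat); simpl in *; lra.
Qed.

(* With 25 b y = 81 y - 9 the upper bound of [PSeries_H_bounds] at y becomes
   (81 / 2) (y - 1 / 9) (y - 2 / 9). *)
Lemma PSeries_H_neg : PSeries H (9 / (81 - 25 * b)) < 0.
Proof.
assert (Hb0 : 0 < b) by now apply weight_pos.
assert (Hb1 : b <= 1) by now apply weight_le_1.
set (y := 9 / (81 - 25 * b)).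
assert (Ey : (81 - 25 * b) * y = 9) by (unfold y; field; lra).
assert (Hy0 : 0 < y) by (apply Rdiv_lt_0_compat; lra).
assert (Hy : 1 / 9 < y <= 1 / 6) by nra.
destruct (PSeries_H_bounds y) as [_ H1]; [lra|].
eapply Rle_lt_trans; [exact H1|].
replace (25 / 2 * b * y ^ 2) with (y * (81 * y - (81 - 25 * b) * y) / 2) by field.
rewrite Ey; nra.
Qed.

(** At the first zero the strict bound [1 - 9 y0 < H(y0) = 0] gives [y0 > 1/9], and strict
    negativity of H at the right end keeps [y0] away from it. *)
Lemma H_first_zero : exists y0, 1 / 9 < y0 < 9 / (81 - 25 * b) /\ y0 < 1 / 6 /\
  PSeries H y0 = 0 /\ forall y, 0 <= y < y0 -> 0 < PSeries H y.
Proof.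
assert (Hb0 : 0 < b) by now apply weight_pos.
assert (Hb1 : b <= 1) by now apply weight_le_1.
assert (HY : 0 < 9 / (81 - 25 * b) < 1 / 6).
{ split; [apply Rdiv_lt_0_compat; lra|].
  apply Rmult_lt_reg_r with (81 - 25 * b); [lra|].
  replace (9 / (81 - 25 * b) * (81 - 25 * b)) with 9 by (field; lra); lra. }
destruct (first_zero (PSeries H) (9 / (81 - 25 * b))) as (y0 & Hy0 & Hz & Hpos).
- intros x; apply entire_continuous, entire_H.
- lra.
- rewrite PSeries_0; unfold H, G, F, theta, alt; simpl; lra.
- generalize PSeries_H_neg; lra.
- exists y0; repeat split; trivial; try lra.
  + apply Rnot_le_lt; intros Hle.
    destruct (PSeries_H_bounds y0) as [H1 _]; lra.
  + destruct (Rle_lt_or_eq_dec _ _ (proj2 Hy0)) as [|E]; [trivial|].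
    generalize PSeries_H_neg; rewrite <- E, Hz; lra.
Qed.

Lemma gcoef_geometric n : gcoef beta (S n) <= 3 * (5 / 6) ^ n.
Proof.
induction n as [|n IH].
- unfold gcoef; simpl; rewrite (weight_0 _ Hb); lra.
- destruct (gcoef_S_le beta n Hb) as [H1 _]; simpl in *; lra.
Qed.

(** The real part of G(w) differs from 1 by at most the sum of [3 (5/6)^n (1/6)^(n+1)], which is
    18/31. *)
Lemma Re_CPSeries_G_pos (w : C) : Cmod w <= 1 / 6 -> 0 < Re (CPSeries G w).
Proof.
intros Hw; assert (Hw0 := Cmod_ge_0 w).
assert (S1 := CPSeries_summable G w (entire_G _ Hw0)).
unfold CPSeries; rewrite CSeries_incr_1 by trivial.
destruct (CSeries_bound (fun n => RtoC (G (S n)) * w ^ S n)%C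
  (fun n => 1 / 2 * (5 / 36) ^ n)) as [HR _].
- intros n; rewrite Cmod_mult, Cmod_R, Cmod_pow, G_gcoef.
  rewrite Rabs_alt by now apply Rlt_le, gcoef_pos.
  assert (Cmod w ^ S n <= (1 / 6) ^ S n) by (apply pow_incr; lra).
  replace (1 / 2 * (5 / 36) ^ n) with (3 * (5 / 6) ^ n * (1 / 6) ^ S n).
  + apply Rmult_le_compat; trivial; [now apply Rlt_le, gcoef_pos|now apply pow_le|].
    apply gcoef_geometric.
  + replace (5 / 36) with (5 / 6 * (1 / 6)) by field.
    rewrite Rpow_mult_distr; simpl; field.
- apply (ex_series_scal_l (V := R_NormedModule) (1 / 2)), ex_series_geom.
  rewrite Rabs_pos_eq; lra.
- rewrite Series_scal_l, Series_geom in HR by (rewrite Rabs_pos_eq; lra).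
  replace (RtoC (G 0%nat) * w ^ 0)%C with (RtoC 1).
  + change (0 < 1 + Re (CSeries (fun n => RtoC (G (S n)) * w ^ S n)%C)).
    apply Rabs_le_between in HR; lra.
  + unfold G, F, theta, alt; simpl.
    replace ((2 * 0 + 1) * (1 * 1)) with 1 by ring; ring.
Qed.

Lemma PSeries_G_pos (y : R) : 0 <= y <= 1 / 6 -> 0 < PSeries G y.
Proof.
intros Hy; generalize (Re_CPSeries_G_pos (RtoC y)).
rewrite CPSeries_R, Cmod_R, Rabs_pos_eq by lra; intros HG; apply HG; lra.
Qed.

(** Both ranges of [b] yield nonnegative coefficients of U = - G' / G with ratios at most 3. The
    resulting geometric bound makes U converge for |w| < 1/3, hence on the disc of radius 1/6. *)
Lemma log_derivative_coefs : exists u : nat -> R,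
  (forall n, 0 <= u n <= 3 * 3 ^ n) /\
  (forall n, sum_f_R0 (fun k => G k * u (n - k)%nat) n = - PS_derive G n).
Proof.
destruct (power_series_division G (fun n => - PS_derive G n)) as [u Hu].
{ unfold G, F, theta, alt; simpl; ring. }
exists u; split; [|trivial].
assert (Hu' : forall n,
  sum_f_R0 (fun k => (-1) ^ k * gcoef beta k * u (n - k)%nat) n
  = (-1) ^ n * (INR (S n) * gcoef beta (S n))).
{ intros n; transitivity (- PS_derive G n).
  - rewrite <- Hu; apply sum_eq; intros k _; now rewrite G_gcoef.
  - unfold PS_derive; rewrite G_gcoef; unfold alt; simpl pow; ring. }
assert (Hr : forall n, 0 <= u n /\ u (S n) <= 3 * u n).
{ intros n; destruct (Rle_lt_dec b (9 / 10)) as [Hflat|Hsteep].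
  - destruct (newton_ratio_flat beta u Hb Hu' Hflat n) as [H1 H2].
    split; [apply H1; lia|apply H2; lia].
  - destruct (newton_ratio_steep beta u Hb Hu' (Rlt_le _ _ Hsteep) n)
      as (H1 & H2 & H3).
    split; [apply H1; lia|]; destruct n as [|n].
    + generalize (H1 0%nat ltac:(lia)); lra.
    + generalize (H3 n ltac:(lia)) (H1 (S n) ltac:(lia)); lra. }
intros n; split; [apply Hr|].
induction n as [|n IH].
- generalize (newton_0 beta u Hb Hu'); simpl; lra.
- generalize (proj2 (Hr n)); simpl; lra.
Qed.

(* H / G = 1 - 2 w U(w) where U has nonnegative coefficients, so its real
   part on a circle is smallest at the positive real point. *)
Lemma Re_H_div_G (w : C) : Cmod w <= 1 / 6 ->
  PSeries H (Cmod w) / PSeries G (Cmod w) <= Re (CPSeries H w / CPSeries G w)%C.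
Proof.
intros Hw; assert (Hw0 := Cmod_ge_0 w).
destruct log_derivative_coefs as (u & Hu & HuG).
assert (Hs : forall r, 0 <= r <= 1 / 6 -> abs_summable_at u r).
{ intros r Hr; unfold abs_summable_at.
  apply ex_series_le_pos with (fun n => 3 * (1 / 2) ^ n).
  - intros n; destruct (Hu n); rewrite Rabs_pos_eq by trivial.
    assert (Hrn : 0 <= r ^ n) by now apply pow_le.
    split; [now apply Rmult_le_pos|].
    replace (1 / 2) with (3 * (1 / 6)) by field; rewrite Rpow_mult_distr.
    rewrite <- Rmult_assoc; apply Rmult_le_compat; trivial.
    now apply pow_incr.
  - apply (ex_series_scal_l (V := R_NormedModule) 3), ex_series_geom.
    rewrite Rabs_pos_eq; lra. }
(* Combine [H = G + 2 z G'] with [G U = - G']. *)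
assert (HHG : forall z, Cmod z <= 1 / 6 ->
  CPSeries H z = (CPSeries G z * (1 - RtoC 2 * (z * CPSeries u z)))%C).
{ intros z Hz; assert (Hz0 := Cmod_ge_0 z).
  unfold H at 1; rewrite CPSeries_theta by apply entire_G.
  assert (E : CPSeries (fun n => - PS_derive G n) z
    = (- CPSeries (PS_derive G) z)%C).
  { transitivity (- (1) * CPSeries (PS_derive G) z)%C.
    - unfold CPSeries; rewrite <- CSeries_scal.
      + apply CSeries_ext; intros n.
        rewrite RtoC_opp; ring.
      + apply CPSeries_summable, entire_PS_derive; [apply entire_G|trivial].
    - ring. }
  rewrite (CPSeries_mult G u _ z HuG) in E by (try apply Hs; try apply entire_G; lra).
  replace (CPSeries (PS_derive G) z) with (- (- CPSeries (PS_derive G) z))%C by ring.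
  rewrite <- E; ring. }
assert (HG := Re_CPSeries_G_pos w Hw).
assert (HG0 : CPSeries G w <> RtoC 0)
  by (intros E; rewrite E in HG; unfold Re, RtoC in HG; simpl in HG; lra).
assert (HGr := PSeries_G_pos (Cmod w) (conj Hw0 Hw)).
set (r := Cmod w) in *.
assert (HHr : PSeries H r = PSeries G r * (1 - 2 * (r * PSeries u r))).
{ apply RtoC_inj; rewrite <- CPSeries_R, HHG
    by (rewrite Cmod_R, Rabs_pos_eq; trivial).
  rewrite !CPSeries_R, RtoC_mult, RtoC_minus, !RtoC_mult; reflexivity. }
rewrite (HHG w Hw), HHr.
replace (_ / _) with (1 - 2 * (r * PSeries u r)) by (field; lra).
replace (_ / _)%C with (1 - RtoC 2 * (w * CPSeries u w))%C by (field; trivial).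
assert (Ssum := CPSeries_summable u w (Hs r (conj Hw0 Hw))).
(* By nonnegativity of [u], the termwise moduli of [w U(w)] sum exactly to [r U(r)]. *)
destruct (CSeries_bound (fun n => w * (RtoC (u n) * w ^ n))%C
  (fun n => r * (u n * r ^ n))) as [HR _].
- intros n; rewrite !Cmod_mult, Cmod_R, Cmod_pow; fold r.
  rewrite (Rabs_pos_eq (u n)) by apply Hu; lra.
- apply (ex_series_scal_l (V := R_NormedModule) r).
  eapply ex_series_ext; [|exact (Hs r (conj Hw0 Hw))]; intros n; simpl.
  rewrite Rabs_pos_eq; [reflexivity|apply Hu].
- rewrite CSeries_scal, Series_scal_l in HR by trivial.
  change (CSeries _) with (CPSeries u w) in HR.
  change (Series _) with (PSeries u r) in HR.
  replace (Re _) with (1 - 2 * Re (w * CPSeries u w)%C)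
    by (unfold Re, RtoC; simpl; ring).
  apply Rabs_le_between in HR; lra.
Qed.

End Core.

(** * Euler's Gamma integral *)

Lemma ex_RInt_right (f : R -> R) (u v : R) : (forall t, 0 < t -> continuous f t) ->
  0 < u -> 0 < v -> ex_RInt f u v.
Proof.
intros Hc Hu Hv; apply (ex_RInt_continuous (V := R_CompleteNormedModule)).
intros t Ht; apply Hc; revert Ht; unfold Rmin; destruct Rle_dec; lra.
Qed.

(** For a nonnegative integrand the integrals grow with the interval, so they converge to their
    supremum [l]. *)
Lemma is_RInt_gen_bounded (f : R -> R) (M : R) :
  (forall t, 0 < t -> continuous f t) -> (forall t, 0 < t -> 0 <= f t) ->
  (forall u v, 0 < u <= v -> RInt f u v <= M) ->
  exists l, is_RInt_gen f (at_right 0) (Rbar_locally p_infty) l /\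
    forall u v, 0 < u <= v -> RInt f u v <= l.
Proof.
intros Hc Hpos HM.
assert (Hex := fun u v => ex_RInt_right f u v Hc).
destruct (completeness (fun I => exists u v, 0 < u <= v /\ I = RInt f u v))
  as [l [Hub Hlub]].
- exists M; intros I (u & v & Huv & ->); now apply HM.
- exists (RInt f 1 1), 1, 1; split; [lra|reflexivity].
- assert (Hl : forall u v, 0 < u <= v -> RInt f u v <= l)
    by (intros u v Huv; apply Hub; now exists u, v).
  exists l; split; trivial.
  intros P [eps HP].
  (* One interval comes within [eps] of the supremum, and every larger interval does at least as
     well. *)
  assert (Hw : exists u0 v0, 0 < u0 <= v0 /\ l - eps < RInt f u0 v0).
  { destruct (classic
      (exists u0 v0, 0 < u0 <= v0 /\ l - eps < RInt f u0 v0)) as [|Hn]; trivial.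
    assert (l <= l - eps); [|generalize (cond_pos eps); lra].
    apply Hlub; intros I (u & v & Huv & ->); apply Rnot_lt_le; intros Hlt.
    apply Hn; now exists u, v. }
  destruct Hw as (u0 & v0 & Huv0 & Hlt).
  apply (Filter_prod _ _ _ (fun u => 0 < u < u0) (fun v => v0 < v)).
  + exists (mkposreal u0 (proj1 Huv0)); intros u Hu Hu0; simpl in Hu.
    change (Rabs (u - 0) < u0) in Hu; rewrite Rminus_0_r in Hu.
    apply Rabs_def2 in Hu; lra.
  + exists v0; trivial.
  + intros u v Hu Hv; exists (RInt f u v); split.
    * apply (RInt_correct (V := R_CompleteNormedModule)), Hex; simpl; lra.
    * apply HP; change (Rabs (RInt f u v - l) < eps).
      assert (E : RInt f u v = RInt f u u0 + (RInt f u0 v0 + RInt f v0 v)).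
      { rewrite <- (RInt_Chasles f u u0 v) by (apply Hex; lra).
        rewrite <- (RInt_Chasles f u0 v0 v) by (apply Hex; lra); reflexivity. }
      assert (0 <= RInt f u u0)
        by (apply RInt_ge_0; [lra|apply Hex; lra|intros; apply Hpos; lra]).
      assert (0 <= RInt f v0 v)
        by (apply RInt_ge_0; [lra|apply Hex; lra|intros; apply Hpos; lra]).
      assert (RInt f u v <= l) by (apply Hl; lra).
      apply Rabs_def1; generalize (cond_pos eps); lra.
Qed.

Lemma exp_nondecreasing (x y : R) : x <= y -> exp x <= exp y.
Proof. intros [H| ->]; [now apply Rlt_le, exp_increasing|lra]. Qed.

Definition gamma_integrand (x t : R) : R := Rpower t (x - 1) * exp (- t).

Lemma gamma_integrand_continuous x t : 0 < t -> continuous (gamma_integrand x) t.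
Proof.
intros Ht; apply (ex_derive_continuous (V := R_NormedModule)).
unfold gamma_integrand, Rpower; auto_derive; trivial.
Qed.

Lemma gamma_integrand_pos x t : 0 < gamma_integrand x t.
Proof. apply Rmult_lt_0_compat; apply exp_pos. Qed.

(** [ln s <= s - 1] at [s = t / y] gives [y ln t - t <= y ln y - y]. *)
Lemma Rpower_exp_bounded (y t : R) : 0 < y -> 0 < t ->
  Rpower t y * exp (- t) <= exp (y * ln y).
Proof.
intros Hy Ht; unfold Rpower; rewrite <- exp_plus.
assert (Hs : ln (t / y) <= t / y - 1).
{ assert (Hty : 0 < t / y) by now apply Rdiv_lt_0_compat.
  generalize (exp_ineq1_le (ln (t / y))); rewrite exp_ln by trivial; lra. }
rewrite ln_div in Hs by trivial.
assert (Hm : y * (ln t - ln y) <= t - y).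
{ replace (t - y) with (y * (t / y - 1)) by (field; lra).
  apply Rmult_le_compat_l; lra. }
apply exp_nondecreasing; lra.
Qed.

(* The integrand is dominated by a multiple of the derivative of the bounded
   function t^x / (1 + t^x). *)
Lemma gamma_integrand_bound (x u v : R) : 0 < x -> 0 < u <= v ->
  RInt (gamma_integrand x) u v
  <= (1 + 2 * exp (x * ln x) + exp (2 * x * ln (2 * x))) / x.
Proof.
intros Hx Huv.
set (K := (1 + 2 * exp (x * ln x) + exp (2 * x * ln (2 * x))) / x).
assert (HK : 0 < K).
{ apply Rdiv_lt_0_compat; trivial.
  generalize (exp_pos (x * ln x)) (exp_pos (2 * x * ln (2 * x))); lra. }
pose (h := fun t => K * (1 - / (1 + Rpower t x))).
pose (dh := fun t => K * (x * Rpower t x / t / (1 + Rpower t x) ^ 2)).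
assert (Hp : forall t, 0 < Rpower t x) by (intros; apply exp_pos).
assert (Hd : forall t, 0 < t -> is_derive h t (dh t)).
{ intros t Ht; specialize (Hp t); unfold h, dh, Rpower in *; auto_derive.
  - repeat split; trivial; lra.
  - field; split; lra. }
assert (Hdc : forall t, 0 < t -> continuous dh t).
{ intros t Ht; apply (ex_derive_continuous (V := R_NormedModule)).
  specialize (Hp t); unfold dh, Rpower in *; auto_derive; repeat split; trivial; try lra.
  assert (0 < (1 + exp (x * ln t)) ^ 2) by (apply pow_lt; lra); simpl in *; lra. }
assert (HI : is_RInt dh u v (h v - h u)).
{ apply (is_RInt_derive (V := R_CompleteNormedModule)); intros t Ht.
  - apply Hd; revert Ht; unfold Rmin; destruct Rle_dec; lra.
  - apply Hdc; revert Ht; unfold Rmin; destruct Rle_dec; lra. }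
apply Rle_trans with (RInt dh u v).
- apply RInt_le; [lra| | |].
  + apply ex_RInt_right; try lra; intros; now apply gamma_integrand_continuous.
  + now exists (h v - h u).
  + intros t Ht; assert (Ht0 : 0 < t) by lra.
    (* With [s = t^x], the claim becomes [(1 + s)^2 exp(-t) <= K x]. Expanding the square,
       [exp(-t)], [s exp(-t)] and [s^2 exp(-t)] are bounded by 1, [x^x] and [(2 x)^(2 x)]; this
       dictates the choice of [K]. *)
    assert (B1 := Rpower_exp_bounded x t Hx Ht0).
    assert (B2 := Rpower_exp_bounded (2 * x) t ltac:(lra) Ht0).
    assert (B0 : exp (- t) <= 1) by (rewrite <- exp_0; apply exp_nondecreasing; lra).
    replace (Rpower t (2 * x)) with (Rpower t x * Rpower t x) in B2
      by (rewrite <- Rpower_plus; f_equal; ring).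
    unfold gamma_integrand, dh.
    replace (Rpower t (x - 1)) with (Rpower t x / t).
    2:{ unfold Rminus; rewrite Rpower_plus, Rpower_Ropp, Rpower_1 by lra.
        reflexivity. }
    specialize (Hp t); revert B1 B2 Hp; generalize (Rpower t x); intros s B1 B2 Hs.
    replace (K * (x * s / t / (1 + s) ^ 2))
      with (s / t * (K * x / (1 + s) ^ 2)) by (field; split; lra).
    apply Rmult_le_compat_l; [apply Rlt_le, Rdiv_lt_0_compat; lra|].
    apply Rmult_le_reg_r with ((1 + s) ^ 2); [apply pow_lt; lra|].
    replace (K * x / (1 + s) ^ 2 * (1 + s) ^ 2) with (K * x) by (field; lra).
    replace (K * x) with (1 + 2 * exp (x * ln x) + exp (2 * x * ln (2 * x)))
      by (unfold K; field; lra).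
    lra.
- rewrite (is_RInt_unique _ _ _ _ HI); unfold h.
  assert (0 < / (1 + Rpower v x)) by (apply Rinv_0_lt_compat; specialize (Hp v); lra).
  assert (/ (1 + Rpower u x) <= 1).
  { rewrite <- Rinv_1; apply Rinv_le_contravar; specialize (Hp u); lra. }
  nra.
Qed.

Lemma Gamma_is_RInt_gen (x : R) : 0 < x ->
  is_RInt_gen (gamma_integrand x) (at_right 0) (Rbar_locally p_infty) (Gamma x)
  /\ 0 < Gamma x.
Proof.
intros Hx.
destruct (is_RInt_gen_bounded (gamma_integrand x)
  ((1 + 2 * exp (x * ln x) + exp (2 * x * ln (2 * x))) / x)) as (l & Hl & Hb).
- intros t Ht; now apply gamma_integrand_continuous.
- intros t _; apply Rlt_le, gamma_integrand_pos.
- intros u v; now apply gamma_integrand_bound.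
- assert (E : Gamma x = l).
  { unfold Gamma; fold (gamma_integrand x).
    exact (is_RInt_gen_unique (V := R_CompleteNormedModule)
             (gamma_integrand x) l Hl). }
  rewrite E; split; trivial.
  apply Rlt_le_trans with (RInt (gamma_integrand x) 1 2); [|apply Hb; lra].
  apply RInt_gt_0; [lra| |]; intros t Ht.
  + apply gamma_integrand_pos.
  + apply gamma_integrand_continuous; lra.
Qed.

Lemma Gamma_pos (x : R) : 0 < x -> 0 < Gamma x.
Proof. intros Hx; now apply Gamma_is_RInt_gen. Qed.

Lemma filterlim_Rpower_exp_0 x : 0 < x ->
  filterlim (fun t => Rpower t x * exp (- t)) (at_right 0) (locally 0).
Proof.
intros Hx; apply filterlim_locally; intros eps.
(* The threshold is [eps^(1/x)]. *)
exists (mkposreal (exp (ln eps / x)) (exp_pos _)); intros t Ht Ht0.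
change (Rabs (t - 0) < exp (ln eps / x)) in Ht; rewrite Rminus_0_r in Ht.
rewrite Rabs_pos_eq in Ht by lra.
change (Rabs (Rpower t x * exp (- t) - 0) < eps); rewrite Rminus_0_r.
assert (P : 0 < Rpower t x) by apply exp_pos.
assert (P2 := exp_pos (- t)).
rewrite Rabs_pos_eq by (apply Rmult_le_pos; lra).
assert (exp (- t) <= 1) by (rewrite <- exp_0; apply exp_nondecreasing; lra).
assert (Rpower t x < eps); [|nra].
rewrite <- (exp_ln eps) by apply cond_pos; apply exp_increasing.
assert (ln t < ln eps / x) by (rewrite <- (ln_exp (ln eps / x)); now apply ln_increasing).
replace (ln eps) with (x * (ln eps / x)) by (field; lra).
now apply Rmult_lt_compat_l.
Qed.

(** One spare power suffices: [t^(x+1) exp(-t) <= K] gives [t^x exp(-t) <= K / t]. *)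
Lemma filterlim_Rpower_exp_infty x : 0 < x ->
  filterlim (fun t => Rpower t x * exp (- t)) (Rbar_locally p_infty) (locally 0).
Proof.
intros Hx; apply filterlim_locally; intros eps.
set (K := exp ((x + 1) * ln (x + 1))).
assert (HK : 0 < K) by apply exp_pos.
assert (Heps := cond_pos eps).
assert (HKe : 0 < K / eps) by now apply Rdiv_lt_0_compat.
exists (K / eps); intros t Ht; assert (Ht0 : 0 < t) by lra.
change (Rabs (Rpower t x * exp (- t) - 0) < eps); rewrite Rminus_0_r.
assert (P : 0 < Rpower t x * exp (- t))
  by (apply Rmult_lt_0_compat; apply exp_pos).
rewrite Rabs_pos_eq by lra.
assert (B := Rpower_exp_bounded (x + 1) t ltac:(lra) Ht0); fold K in B.
rewrite Rpower_plus, Rpower_1 in B by trivial.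
apply Rmult_lt_reg_r with t; trivial.
assert (K < eps * t); [|lra].
apply Rmult_lt_compat_l with (r := eps) in Ht; [|trivial].
replace (eps * (K / eps)) with K in Ht by (field; lra); trivial.
Qed.

(** Integration by parts: [P t = t^x exp(-t)] vanishes at both ends, and its derivative is [x] times
    the integrand at [x] minus the integrand at [x + 1]. *)
Lemma Gamma_succ (x : R) : 0 < x -> Gamma (x + 1) = x * Gamma x.
Proof.
intros Hx.
destruct (Gamma_is_RInt_gen x Hx) as [H1 _].
destruct (Gamma_is_RInt_gen (x + 1) ltac:(lra)) as [H2 _].
pose (P := fun t => Rpower t x * exp (- t)).
assert (HD : forall t, 0 < t ->
  is_derive P t (x * gamma_integrand x t - gamma_integrand (x + 1) t)).
{ intros t Ht; unfold P, gamma_integrand.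
  replace (x + 1 - 1) with x by ring.
  replace (Rpower t (x - 1)) with (Rpower t x / t).
  2:{ unfold Rminus; rewrite Rpower_plus, Rpower_Ropp, Rpower_1 by lra.
      reflexivity. }
  unfold Rpower; auto_derive; [trivial|field; lra]. }
assert (Hin : filter_prod (at_right 0) (Rbar_locally p_infty)
  (fun ab : R * R => forall t, Rmin (fst ab) (snd ab) <= t <= Rmax (fst ab) (snd ab)
     -> 0 < t)).
{ apply (Filter_prod _ _ _ (fun u => 0 < u) (fun v => 0 < v)).
  - exists (mkposreal 1 Rlt_0_1); trivial.
  - exists 0; trivial.
  - intros u v Hu Hv t; simpl; unfold Rmin; destruct Rle_dec; lra. }
assert (H3 : is_RInt_gen (Derive P) (at_right 0) (Rbar_locally p_infty) (0 - 0)).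
{ apply is_RInt_gen_Derive.
  - apply filter_imp with (2 := Hin); intros ab Hab t Ht.
    eexists; apply HD; now apply (Hab t).
  - apply filter_imp with (2 := Hin); intros ab Hab t Ht.
    assert (Ht0 : 0 < t) by now apply (Hab t).
    (* The formula for [Derive P] is available for positive arguments only, so continuity is
       transferred on a neighbourhood of [t] inside the half-line. *)
    apply continuous_ext_loc
      with (fun t => x * gamma_integrand x t - gamma_integrand (x + 1) t).
    + exists (mkposreal t Ht0); intros s Hs.
      change (Rabs (s - t) < t) in Hs; apply Rabs_def2 in Hs.
      symmetry; apply is_derive_unique, HD; lra.
    + apply (continuous_minus (V := R_NormedModule)).
      * apply (continuous_scal_r (V := R_NormedModule) x).
        now apply gamma_integrand_continuous.
      * now apply gamma_integrand_continuous.
  - now apply filterlim_Rpower_exp_0.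
  - now apply filterlim_Rpower_exp_infty. }
assert (H4 : is_RInt_gen (Derive P) (at_right 0) (Rbar_locally p_infty)
   (x * Gamma x - Gamma (x + 1))).
{ eapply is_RInt_gen_ext;
    [|exact (is_RInt_gen_minus _ _ _ _ (is_RInt_gen_scal _ x _ H1) H2)].
  apply filter_imp with (2 := Hin); intros ab Hab t Ht; simpl.
  symmetry; apply is_derive_unique, HD, Hab; lra. }
assert (E := is_RInt_gen_unique (V := R_CompleteNormedModule) _ _ H3).
assert (E' := is_RInt_gen_unique (V := R_CompleteNormedModule) _ _ H4).
rewrite E in E'; lra.
Qed.

(** * Rising factorials as quotients of Gamma values *)

Fixpoint rising (a : R) (q : nat) : R :=
  match q with O => 1 | S q => rising a q * (a + INR q) end.

Lemma rising_pos a q : 0 < a -> 0 < rising a q.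
Proof.
intros Ha; induction q as [|q IH]; simpl; [lra|].
apply Rmult_lt_0_compat; [trivial|generalize (pos_INR q); lra].
Qed.

Lemma Gamma_rising a q : 0 < a -> Gamma (INR q + a) = rising a q * Gamma a.
Proof.
intros Ha; induction q as [|q IH].
- simpl; rewrite Rplus_0_l; ring.
- rewrite S_INR; replace (INR q + 1 + a) with (INR q + a + 1) by ring.
  rewrite Gamma_succ, IH by (generalize (pos_INR q); lra); simpl; ring.
Qed.

Lemma rising_le a a' q : 0 < a <= a' -> rising a q <= rising a' q.
Proof.
intros Ha; induction q as [|q IH]; simpl; [lra|].
assert (0 < rising a q) by (apply rising_pos; lra).
generalize (pos_INR q); intros; apply Rmult_le_compat; lra.
Qed.

(** Factor by factor, [(a + i) (a + 2 d + i) <= (a + d + i)^2], the difference being [d^2]. With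
    [d = q] this is the source of [weight_2]. *)
Lemma rising_log_concave a d q : 0 < a -> 0 <= d ->
  rising a q * rising (a + 2 * d) q <= rising (a + d) q ^ 2.
Proof.
intros Ha Hd; induction q as [|q IH]; simpl rising; [lra|].
assert (P0 : 0 < rising a q) by (apply rising_pos; lra).
assert (P2 : 0 < rising (a + 2 * d) q) by (apply rising_pos; lra).
generalize (pos_INR q); intros Hq.
replace (rising a q * (a + INR q) * (rising (a + 2 * d) q * (a + 2 * d + INR q)))
  with (rising a q * rising (a + 2 * d) q * ((a + INR q) * (a + 2 * d + INR q))) by ring.
rewrite Rpow_mult_distr; apply Rmult_le_compat; [nra|nra|trivial|nra].
Qed.

(** * The radius of convexity *)

(* [is_derive_mult] and [is_derive_id] live in [AbsRing_NormedModule C_AbsRing],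
   whose uniform structure is not convertible to that of [C_NormedModule]. *)
Lemma is_derive_C_iff (f : C -> C) (z l : C) :
  is_derive (K := C_AbsRing) (V := AbsRing_NormedModule C_AbsRing) f z l <->
  is_derive (K := C_AbsRing) (V := C_NormedModule) f z l.
Proof. split; intros [_ Hd]; split; try apply is_linear_scal_l; exact Hd. Qed.

Lemma is_derive_Cmult (f g : C -> C) (z df dg : C) :
  is_derive (K := C_AbsRing) (V := C_NormedModule) f z df ->
  is_derive (K := C_AbsRing) (V := C_NormedModule) g z dg ->
  is_derive (K := C_AbsRing) (V := C_NormedModule)
    (fun z => f z * g z)%C z (df * g z + f z * dg)%C.
Proof.
intros Hf Hg; apply is_derive_C_iff in Hf, Hg; apply is_derive_C_iff.
exact (is_derive_mult (K := C_AbsRing) f g z df dg Hf Hg Cmult_comm).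
Qed.

Lemma is_derive_Cid (z : C) :
  is_derive (K := C_AbsRing) (V := C_NormedModule) (fun z => z) z (RtoC 1).
Proof. apply is_derive_C_iff; exact (is_derive_id (K := C_AbsRing) z). Qed.

Lemma is_derive_CPSeries_sqr A (k : R) (z : C) : entire A ->
  is_derive (K := C_AbsRing) (V := C_NormedModule)
    (fun z => CPSeries A (RtoC k * (z * z))%C) z
    (RtoC 2 * RtoC k * z * CPSeries (PS_derive A) (RtoC k * (z * z)))%C.
Proof.
intros HA.
assert (Hsq : is_derive (K := C_AbsRing) (V := C_NormedModule)
   (fun z => RtoC k * (z * z))%C z (RtoC 2 * RtoC k * z)%C).
{ replace (RtoC 2 * RtoC k * z)%C
    with (RtoC 0 * (z * z) + RtoC k * (1 * z + z * 1))%C by ring.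
  apply (is_derive_Cmult (fun _ => RtoC k) (fun z => z * z)%C).
  - exact (is_derive_const (K := C_AbsRing) (V := C_NormedModule) (RtoC k) z).
  - apply (is_derive_Cmult (fun z => z) (fun z => z)); apply is_derive_Cid. }
apply is_derive_C_iff in Hsq.
exact (is_derive_comp (K := C_AbsRing) (V := C_NormedModule) (CPSeries A)
  (fun z => RtoC k * (z * z))%C z _ _ (CPSeries_is_derive A _ HA) Hsq).
Qed.

Lemma is_derive_mult_CPSeries_sqr A (k : R) (z : C) : entire A ->
  is_derive (K := C_AbsRing) (V := C_NormedModule)
    (fun z => z * CPSeries A (RtoC k * (z * z)))%C z
    (CPSeries (theta A) (RtoC k * (z * z))%C).
Proof.
intros HA; rewrite CPSeries_theta by trivial.
replace (_ + _)%C with (1 * CPSeries A (RtoC k * (z * z))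
  + z * (RtoC 2 * RtoC k * z * CPSeries (PS_derive A) (RtoC k * (z * z))))%C by ring.
apply (is_derive_Cmult (fun z => z) (fun z => CPSeries A (RtoC k * (z * z))%C));
  [apply is_derive_Cid|now apply is_derive_CPSeries_sqr].
Qed.

(** * Odd entire functions of the form [z F(k z^2)] *)

Section OddSeries.
Variables (beta : nat -> R) (k : R) (g : C -> C).
Hypothesis Hb : weights beta.
Hypothesis Hk : 0 < k.
Let F := alt (fcoef beta).
Let G := theta F.
Let H := theta G.
Hypothesis Hg : forall z, g z = (z * CPSeries F (RtoC k * (z * z)))%C.

Lemma C_derive_g z : C_derive g z = CPSeries G (RtoC k * (z * z))%C.
Proof.
apply is_C_derive_unique.
eapply is_derive_ext; [intros t; symmetry; apply Hg|].
now apply is_derive_mult_CPSeries_sqr, entire_F.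
Qed.

Lemma C_derive_z_g' z :
  C_derive (fun z => z * C_derive g z)%C z = CPSeries H (RtoC k * (z * z))%C.
Proof.
apply is_C_derive_unique.
apply is_derive_ext with (fun z => z * CPSeries G (RtoC k * (z * z)))%C;
  [intros t; now rewrite C_derive_g|].
now apply is_derive_mult_CPSeries_sqr, entire_G.
Qed.

Lemma one_plus_z_g''_div_g' z : CPSeries G (RtoC k * (z * z))%C <> RtoC 0 ->
  (RtoC 1 + z * C_derive (C_derive g) z / C_derive g z)%C
  = (CPSeries H (RtoC k * (z * z)) / CPSeries G (RtoC k * (z * z)))%C.
Proof.
intros HG.
assert (E : C_derive (C_derive g) z
  = (RtoC 2 * RtoC k * z * CPSeries (PS_derive G) (RtoC k * (z * z)))%C).
{ apply is_C_derive_unique.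
  eapply is_derive_ext; [intros t; symmetry; apply C_derive_g|].
  now apply is_derive_CPSeries_sqr, entire_G. }
rewrite E, C_derive_g; unfold H.
rewrite CPSeries_theta by now apply entire_G.
field; trivial.
Qed.

(** The substitution [w = k z^2] maps the disc of radius [r] into |w| < [y0], where [k r^2 = y0];
    there the real part of H / G is positive, and at [z = r] it vanishes. *)
Lemma radius_of_convexity_odd_series : exists r y0 : R,
  r = sqrt (y0 / k) /\ 1 / 9 < y0 < 9 / (81 - 25 * beta 1%nat) /\
  radius_of_convexity g = Finite r /\
  is_smallest_positive_root (C_derive (fun z : C => (z * C_derive g z)%C)) r.
Proof.
destruct (H_first_zero beta Hb) as (y0 & Hy0 & Hy6 & Hz & Hpos).
assert (Hr2 : 0 < y0 / k) by (apply Rdiv_lt_0_compat; lra).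
set (r := sqrt (y0 / k)).
assert (Hr0 : 0 < r) by now apply sqrt_lt_R0.
assert (Hr : k * (r * r) = y0).
{ unfold r; rewrite sqrt_sqrt by lra; field; lra. }
assert (Hlt : forall t, 0 <= t < r -> 0 <= k * (t * t) < y0).
{ intros t Ht; split; [nra|]; rewrite <- Hr.
  apply Rmult_lt_compat_l; nra. }
assert (ER : forall x, (RtoC k * (RtoC x * RtoC x))%C = RtoC (k * (x * x)))
  by (intros x; now rewrite !RtoC_mult).
exists r, y0; repeat split; trivial; try lra.
- apply is_lub_Rbar_unique; split.
  (* A radius beyond [r] would admit the point [z = r], where G is nonzero by the admissibility
     condition and H / G is 0. *)
  + intros s [Hs0 Hs]; apply Rnot_lt_le; intros Hrs.
    destruct (Hs (RtoC r)) as [Hne Hre].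
    { rewrite Cmod_R, Rabs_pos_eq; lra. }
    rewrite C_derive_g in Hne.
    rewrite one_plus_z_g''_div_g' in Hre by trivial.
    rewrite ER, Hr in Hre, Hne; unfold H in Hre.
    rewrite (CPSeries_R (theta G)) in Hre; change (theta G) with (theta (theta F)) in Hre.
    unfold F in Hre; rewrite Hz in Hre.
    unfold Cdiv in Hre; rewrite Cmult_0_l in Hre.
    simpl in Hre; lra.
  (* [r] is itself admissible, hence below every upper bound. *)
  + intros B HB; apply HB; split; trivial; intros z Hzr.
    assert (Hz0 := Cmod_ge_0 z).
    assert (Hw := Hlt (Cmod z) (conj Hz0 Hzr)).
    assert (Ew : Cmod (RtoC k * (z * z))%C = k * (Cmod z * Cmod z)).
    { rewrite !Cmod_mult, Cmod_R, Rabs_pos_eq; lra. }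
    assert (HG := Re_CPSeries_G_pos beta Hb (RtoC k * (z * z))%C ltac:(lra)).
    assert (HG0 : CPSeries G (RtoC k * (z * z))%C <> RtoC 0).
    { intros E; fold F in HG; fold G in HG; rewrite E in HG; simpl in HG; lra. }
    split; [now rewrite C_derive_g|].
    rewrite one_plus_z_g''_div_g' by trivial.
    eapply Rlt_le_trans; [|apply Re_H_div_G; trivial; lra].
    rewrite Ew; apply Rdiv_lt_0_compat; [now apply Hpos|].
    apply PSeries_G_pos; trivial; lra.
- rewrite C_derive_z_g', ER, Hr, CPSeries_R.
  now apply (f_equal RtoC).
- intros x Hx; rewrite C_derive_z_g', ER, CPSeries_R; intros E.
  apply RtoC_inj in E.
  assert (Hp := Hpos (k * (x * x)) (Hlt x ltac:(lra))).
  revert Hp; unfold H, G, F in E; rewrite E; lra.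
Qed.

End OddSeries.

(** * Specialization to the Struve coefficients *)

(** This is [kappa_n / kappa_0] for [kappa_n = Gamma(q n + a) / Gamma(q n + q + a)], with the Gamma
    quotients rewritten as rising factorials. *)
Definition struve_weight (q : nat) (a : R) (n : nat) : R :=
  rising a q / rising (a + INR n * INR q) q.

Lemma struve_weights q a : 0 < a -> weights (struve_weight q a).
Proof.
intros Ha.
assert (Hq := pos_INR q).
assert (Hn : forall n, 0 < a + INR n * INR q)
  by (intros n; generalize (pos_INR n); nra).
assert (Hp : forall n, 0 < rising (a + INR n * INR q) q)
  by (intros n; apply rising_pos, Hn).
assert (Hp0 : 0 < rising a q) by now apply rising_pos.
unfold struve_weight; split.
- simpl; rewrite Rmult_0_l, Rplus_0_r; field; lra.
- intros n; now apply Rdiv_lt_0_compat.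
- intros n; apply Rmult_le_compat_l; [lra|].
  apply Rinv_le_contravar; [apply Hp|].
  apply rising_le; split; [apply Hn|]; rewrite S_INR; lra.
- assert (H1 := Hp 1%nat); assert (H2 := Hp 2%nat); simpl INR in *.
  replace (1 * INR q) with (INR q) in * by ring.
  replace (1 + 1) with 2 in * by ring.
  assert (HL := rising_log_concave a (INR q) q Ha Hq).
  revert H1 H2 Hp0 HL; generalize (rising (a + INR q) q), (rising (a + 2 * INR q) q),
    (rising a q); intros x y z Hx Hy Hz HL.
  apply Rmult_le_reg_r with (x ^ 2 * y); [apply Rmult_lt_0_compat; nra|].
  replace ((z / x) ^ 2 * (x ^ 2 * y)) with (z * (z * y)) by (field; lra).
  replace (z / y * (x ^ 2 * y)) with (z * x ^ 2) by (field; lra).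
  apply Rmult_le_compat_l; lra.
Qed.

(** Apart from the sign, consecutive coefficients on both sides have the ratio
    [c / (4 (n + 1) rising (q n + a) q)]. *)
Lemma struve_g_coef q p b c delta n :
  let a := struve_a p b delta in 0 < a ->
  Gamma a * struve_coef q p b c delta n / 4 ^ n
  = alt (fcoef (struve_weight q a)) n * (c / (4 * rising a q)) ^ n.
Proof.
intros a Ha; unfold struve_coef, alt; fold a.
assert (Hn : forall n, 0 < INR q * INR n + a).
{ intros m; generalize (pos_INR m) (pos_INR q); nra. }
assert (HG := fun m => Gamma_pos _ (Hn m)).
assert (HG0 := Gamma_pos a Ha).
assert (Hr := rising_pos a q Ha).
assert (Hf : forall m, INR (fact m) <> 0) by (intros; apply INR_fact_neq_0).
assert (H4 : forall m, 4 ^ m <> 0) by (intros; apply pow_nonzero; lra).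
replace (Gamma a * ((-1) ^ n * c ^ n / (INR (fact n) * Gamma (INR q * INR n + a))) / 4 ^ n)
  with ((-1) ^ n * (Gamma a * c ^ n / (INR (fact n) * Gamma (INR q * INR n + a)) / 4 ^ n))
  by (field; repeat split; auto; apply Rgt_not_eq, HG).
rewrite Rmult_assoc; f_equal.
induction n as [|n IH].
- simpl; rewrite Rmult_0_r, Rplus_0_l; field; lra.
- change (fcoef (struve_weight q a) (S n))
    with (fcoef (struve_weight q a) n * struve_weight q a n / INR (S n)).
  assert (HrN := rising_pos (INR q * INR n + a) q (Hn n)).
  assert (E : Gamma (INR q * INR (S n) + a)
    = rising (INR q * INR n + a) q * Gamma (INR q * INR n + a)).
  { rewrite <- Gamma_rising by trivial; f_equal; rewrite S_INR; ring. }
  rewrite E, fact_simpl, mult_INR.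
  transitivity (Gamma a * c ^ n / (INR (fact n) * Gamma (INR q * INR n + a)) / 4 ^ n
    * (c / (4 * INR (S n) * rising (INR q * INR n + a) q))).
  + simpl pow; field; repeat split; auto; try (apply Rgt_not_eq; trivial; apply HG);
      apply not_0_INR; lia.
  + rewrite IH; unfold struve_weight.
    replace (a + INR n * INR q) with (INR q * INR n + a) by ring.
    simpl pow; field; repeat split; try (apply Rgt_not_eq; assumption);
      apply not_0_INR; lia.
Qed.

Lemma struve_g_odd_series q p b c delta z :
  let a := struve_a p b delta in 0 < a ->
  struve_g q p b c delta z
  = (z * CPSeries (alt (fcoef (struve_weight q a)))
           (RtoC (c / (4 * rising a q)) * (z * z)))%C.
Proof.
intros a Ha; unfold CPSeries.
assert (Hb := struve_weights q a Ha).
rewrite <- CSeries_scal by (apply CPSeries_summable, entire_F; trivial; apply Cmod_ge_0).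
apply CSeries_ext; intros n; fold a; unfold a.
rewrite struve_g_coef by trivial; fold a.
rewrite RtoC_mult, RtoC_pow, Cpow_mult_l, Cpow_add_r.
replace (z ^ (2 * n))%C with ((z * z) ^ n)%C; [simpl; ring|].
rewrite Cpow_mult_l, <- Cpow_add_r; f_equal; lia.
Qed.

Theorem theorem2p6 (q : nat) (p b c delta : R)
  (hq : (0 < q)%nat) (hdelta : 0 < delta) (hb : 0 < b) (hc : 0 < c)
  (hp : 0 < p + 1) (ha : 0 < struve_a p b delta) :
  let a := struve_a p b delta in
  let g := struve_g q p b c delta in
  exists r : R,
    radius_of_convexity g = Finite r /\
    is_smallest_positive_root
      (C_derive (fun z : C => (z * C_derive g z)%C)) r /\
    2 / 3 * sqrt (Gamma (INR q + a) / (c * Gamma a)) < r /\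
    r < 6 * sqrt (Gamma (INR q + a) * Gamma (2 * INR q + a)
                  / (c * (81 * Gamma a * Gamma (2 * INR q + a)
                          - 25 * (Gamma (INR q + a)) ^ 2))).
Proof.
intros a g.
assert (Ha : 0 < a) by exact ha.
assert (Hq := pos_INR q).
assert (R1 := rising_pos a q Ha).
assert (R2 := rising_pos (INR q + a) q ltac:(lra)).
assert (R12 := rising_le a (INR q + a) q ltac:(lra)).
assert (HG := Gamma_pos a Ha).
assert (E1 := Gamma_rising a q Ha).
assert (E2 := Gamma_rising (INR q + a) q ltac:(lra)).
replace (INR q + (INR q + a)) with (2 * INR q + a) in E2 by ring.
destruct (radius_of_convexity_odd_series (struve_weight q a)
  (c / (4 * rising a q)) g) as (r & y0 & Er & Hy0 & Hrad & Hroot).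
- now apply struve_weights.
- apply Rdiv_lt_0_compat; lra.
- intros z; now apply struve_g_odd_series.
- unfold struve_weight in Hy0; simpl INR in Hy0.
  replace (a + 1 * INR q) with (INR q + a) in Hy0 by ring.
  exists r; split; [trivial|split; [trivial|]]; rewrite Er, E2, E1.
  assert (Ek : forall y, y / (c / (4 * rising a q)) = y * (4 * rising a q / c))
    by (intros y; field; lra).
  assert (Hk : 0 < 4 * rising a q / c) by (apply Rdiv_lt_0_compat; lra).
  rewrite Ek; clear Ek E1 E2 Er Hrad Hroot.
  revert R1 R2 R12 Hk Hy0 HG.
  (* From here [x1 = Gamma(q + a) / Gamma(a)] and [x2 = Gamma(2 q + a) / Gamma(q + a)], so that
     [1 / k = 4 x1 / c] and [beta 1 = x1 / x2]; both bounds are those on [y0], rescaled. *)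
  generalize (rising a q), (rising (INR q + a) q), (Gamma a).
  intros x1 x2 G0 R1 R2 R12 Hk Hy0 HG; split.
  + replace (2 / 3) with (sqrt (4 / 9)).
    2:{ replace (4 / 9) with (2 / 3 * (2 / 3)) by field; apply sqrt_square; lra. }
    rewrite <- sqrt_mult_alt by lra; apply sqrt_lt_1_alt.
    replace (4 / 9 * (x1 * G0 / (c * G0))) with (1 / 9 * (4 * x1 / c))
      by (field; lra).
    split; [|apply Rmult_lt_compat_r; lra].
    apply Rmult_le_pos; lra.
  + replace 6 with (sqrt 36).
    2:{ replace 36 with (6 * 6) by ring; apply sqrt_square; lra. }
    rewrite <- sqrt_mult_alt by lra; apply sqrt_lt_1_alt.
    (* By [x1 <= x2]; the denominator under the root is [c x1 G0^2 (81 x2 - 25 x1)]. *)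
    assert (D1 : 0 < 81 * x2 - 25 * x1) by lra.
    replace (36 * _) with (9 / (81 - 25 * (x1 / x2)) * (4 * x1 / c)).
    * split; [apply Rmult_le_pos; lra|apply Rmult_lt_compat_r; lra].
    * field; repeat split; try lra.
      replace (_ - _) with (x1 * G0 * G0 * (81 * x2 - 25 * x1)) by ring.
      apply Rgt_not_eq; repeat apply Rmult_lt_0_compat; lra.
Qed.
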